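(* Let $W$ be a càdlàg process on $\mathbb{R}$ with $W(0)=0$ almost surely and $\mathbb{E}\{e^{W(t)}\}=1$ for all $t\in\mathbb{R}$, such that the associated max-stable process $\xi_W$ is stationary and has càdlàg sample paths. Then for any $\delta\ge0$: if $\xi_W^\delta=\{\xi_W(t),t\in\delta\mathbb{Z}\}$ possesses a mixed moving maxima (M3) representation, with associated constant $C_W^\delta$, then $$0<C_W^\delta=\mathbb{E}\left\{\frac{M^\delta}{S^\delta}\right\}\le\mathcal{H}_W^\delta.$$
   Context: The max-stable process associated with $W$ is $\xi_W(t)=\max_{i\ge1}(P_i+W_i(t))$, $t\in\mathbb{R}$, where $\sum_{i\ge 1}\varepsilon_{P_i}$ ($\varepsilon_x$ the unit Dirac measure at $x$) is a Poisson point process on $\mathbb{R}$ with intensity $e^{-x}dx$ and $W_i$, $i\ge1$, are independent copies of $W$, independent of the Poisson process. Stationary means that its law is invariant under all shifts $t\mapsto t+h$, $h\in\mathbb{R}$. Convention: $\delta\mathbb{Z}=\mathbb{R}$ if $\delta=0$. Let $\nu_0$ be the Lebesgue measure on $\mathbb{R}$, and for $\delta>0$ let $\nu_\delta$ be $\delta$ times the counting measure on $\delta\mathbb{Z}$. M3 representation: for $\delta\ge0$, $\xi_W^\delta$ possesses an M3 representation if there is a process $F_W^\delta=\{F_W^\delta(t),t\in\delta\mathbb{Z}\}$ (measurable with càdlàg paths if $\delta=0$) with $\sup_{t\in\delta\mathbb{Z}}F_W^\delta(t)=F_W^\delta(0)=0$ almost surely and $$C_W^\delta=\left(\mathbb{E}\left\{\int_{\delta\mathbb{Z}}\exp(F_W^\delta(t))\,\nu_\delta(dt)\right\}\right)^{-1}\in(0,\infty),$$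 such that, in distribution as processes on $\delta\mathbb{Z}$, $$\xi_W(t)\stackrel{d}{=}\max_{i\ge1}\big(F_i^\delta(t-P_i^\delta)+Q_i^\delta\big),\qquad t\in\delta\mathbb{Z},$$ where $F_i^\delta$ are independent copies of $F_W^\delta$ and $\sum_{i\ge 1}\varepsilon_{(P_i^\delta,Q_i^\delta)}$ is a Poisson point process on $\delta\mathbb{Z}\times\mathbb{R}$, independent of the $F_i^\delta$, with intensity $C_W^\delta\,\nu_\delta(dt)\,e^{-y}dy$. The generalized Pickands constant is $$\mathcal{H}_W^\delta=\lim_{T\to\infty}\frac1T\,\mathbb{E}\Big\{\sup_{t\in\delta\mathbb{Z}\cap[0,T]}e^{W(t)}\Big\}$$ (the limit exists and is finite in this setting), and $$M^\delta=\sup_{t\in\delta\mathbb{Z}}e^{W(t)},\qquad S^\delta=\delta\sum_{t\in\delta\mathbb{Z}}e^{W(t)}\ (\delta>0),\qquad S^0=\int_{\mathbb{R}}e^{W(t)}\,dt.$$ *)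

(* Defs.v *)
From HB Require Import structures.
From mathcomp Require Import all_boot all_order all_algebra finmap.
From mathcomp Require Import all_classical all_reals all_analysis measurable_realfun.
Set Implicit Arguments.
Unset Strict Implicit.
Unset Printing Implicit Defensive.
Import Order.TTheory GRing.Theory Num.Theory.
Import numFieldNormedType.Exports.
Local Open Scope classical_set_scope.
Local Open Scope ring_scope.

Definition cadlag (R : realType) (f : R -> R) : Prop :=
  right_continuous f /\ forall t, cvg (f x @[x --> t^'-]).

(* A process on an index set [D] of [I] is a map [X : T -> I -> U] of which only
   the restriction to [D] is relevant: on paths it is observed through the
   product sigma-algebra generated by the coordinates [t \in D]. *)
Definition path_sigma (I : Type) (d : measure_display) (U : measurableType d)
    (D : set I) : set (set (I -> U)) :=
  <<s [set A | exists2 t, D t &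
         exists2 B : set U, measurable B & A = [set f | B (f t)]] >>.

Definition same_law (I : Type) (d : measure_display) (U : measurableType d)
    (R : realType) (D : set I)
    (d1 : measure_display) (T1 : measurableType d1) (P1 : probability T1 R)
    (X1 : T1 -> I -> U)
    (d2 : measure_display) (T2 : measurableType d2) (P2 : probability T2 R)
    (X2 : T2 -> I -> U) : Prop :=
  forall A, path_sigma D A -> P1 (X1 @^-1` A) = P2 (X2 @^-1` A).

Definition sigma_process (T I : Type) (d : measure_display)
    (U : measurableType d) (D : set I) (X : T -> I -> U) : set (set T) :=
  preimage_set_system setT X (path_sigma D).

Definition independent (d : measure_display) (T : measurableType d)
    (R : realType) (P : probability T R) (I : choiceType)
    (G : I -> set (set T)) : Prop :=
  forall (J : {fset I}) (E : I -> set T), (forall i, i \in J -> G i (E i)) ->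
    P (\bigcap_(i in [set` J]) E i) = (\prod_(i <- J) P (E i))%E.

Definition point_measure (R : realType) (T : Type) (d : measure_display)
    (E : measurableType d) (Z : T -> nat -> E) (w : T) (B : set E) : \bar R :=
  (\sum_(0 <= i <oo) \d_(Z w i) B)%E.

(* The library's [poisson_pmf] is not used, as it is not the Dirac mass at [0] for
   rate [0]. *)
Definition poisson_point_process (R : realType)
    (d : measure_display) (T : measurableType d) (P : probability T R)
    (d' : measure_display) (E : measurableType d')
    (mu : set E -> \bar R) (Z : T -> nat -> E) : Prop :=
  [/\ forall i, measurable_fun setT (fun w => Z w i),
      forall (B : set E) (r : R), measurable B -> mu B = r%:E -> forall k : nat,
        P [set w | point_measure R Z w B = k%:R%:E]
        = (expR (- r) * r ^+ k / k`!%:R)%:E,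
      forall B : set E, measurable B -> mu B = +oo%E ->
        {ae P, forall w, point_measure R Z w B = +oo%E}
    & forall (n : nat) (B : 'I_n -> set E),
        (forall i, measurable (B i)) -> trivIset setT B ->
        independent P (fun i => preimage_set_system setT
          (fun w => point_measure R Z w (B i)) measurable)].

(* [Y_0, Y_1, ...] are independent copies (on the index set [D]) of the process
   [X], independent of the sequence of points [Z]: index [None] stands for [Z]
   and [Some i] for [Y_i]. *)
Definition independent_copies (R : realType) (D : set R)
    (d0 : measure_display) (T0 : measurableType d0) (P0 : probability T0 R)
    (X : T0 -> R -> R)
    (d : measure_display) (T : measurableType d) (P : probability T R)
    (d' : measure_display) (E : measurableType d')
    (Z : T -> nat -> E) (Y : nat -> T -> R -> R) : Prop :=
  (forall i, same_law D P (Y i) P0 X) /\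
  independent P (fun o : option nat =>
    if o is Some i then sigma_process D (Y i) else sigma_process setT Z).

Definition cadlag_process (R : realType)
    (d : measure_display) (T : measurableType d) (W : T -> R -> R) : Prop :=
  (forall t, measurable_fun setT (fun w => W w t)) /\ forall w, cadlag (W w).

Definition exp_intensity (R : realType) (B : set R) : \bar R :=
  (\int[lebesgue_measure]_(x in B) (expR (- x))%:E)%E.

(* [p] and [Y] are the points and the marks in a construction, on the
   probability space [P], of the max-stable process associated with [W]. *)
Definition max_stable_construction (R : realType)
    (d0 : measure_display) (T0 : measurableType d0) (P0 : probability T0 R)
    (W : T0 -> R -> R)
    (d : measure_display) (T : measurableType d) (P : probability T R)
    (p : T -> nat -> R) (Y : nat -> T -> R -> R) : Prop :=
  [/\ poisson_point_process P (@exp_intensity R) p,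
      forall i, cadlag_process (Y i)
    & independent_copies setT P0 W P p Y].

(* Maxima of infinite families are suprema in [\bar R]. *)
Definition max_stable (R : realType) (T : Type)
    (p : T -> nat -> R) (Y : nat -> T -> R -> R) (w : T) (t : R) : \bar R :=
  ereal_sup (range (fun i => (p w i + Y i w t)%:E)).

Definition stationary (R : realType)
    (d : measure_display) (T : measurableType d) (P : probability T R)
    (xi : T -> R -> \bar R) : Prop :=
  forall h : R, same_law setT P (fun w t => xi w (t + h)) P xi.

Definition cadlag_paths (R : realType)
    (d : measure_display) (T : measurableType d) (P : probability T R)
    (xi : T -> R -> \bar R) : Prop :=
  {ae P, forall w, exists2 f : R -> R, cadlag f & forall t, xi w t = (f t)%:E}.

Definition grid (R : realType) (delta : {nonneg R}) : set R :=
  if delta%:num == 0 then setT else range (fun k : int => delta%:num * k%:~R).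

Lemma measurable_grid (R : realType) (delta : {nonneg R}) :
  measurable (grid delta : set (measurableTypeR R)).
Proof.
rewrite /grid; case: ifP => // _.
apply: countable_measurable; first by move=> x; exact: measurable_set1.
exact/(card_le_trans (card_image_le _ _))/countableP.
Qed.

Definition grid_measure (R : realType) (delta : {nonneg R}) :
    {measure set (measurableTypeR R) -> \bar R} :=
  if delta%:num == 0 then [the {measure set _ -> \bar R} of lebesgue_measure]
  else [the {measure set _ -> \bar R} of
          mscale delta (mrestr counting (measurable_grid delta))].

Definition shape_process (R : realType) (delta : {nonneg R})
    (d : measure_display) (T : measurableType d) (F : T -> R -> R) : Prop :=
  (forall t, grid delta t -> measurable_fun setT (fun w => F w t)) /\
  (delta%:num = 0 ->
    measurable_fun setT (fun wt : T * R => F wt.1 wt.2) /\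
    forall w, cadlag (F w)).

Definition m3_constant (R : realType) (delta : {nonneg R})
    (d : measure_display) (T : measurableType d) (P : probability T R)
    (F : T -> R -> R) : \bar R :=
  (\int[P]_w \int[grid_measure delta]_(t in grid delta) (expR (F w t))%:E)^-1%E.

Definition m3_intensity (R : realType) (delta : {nonneg R}) (C : R)
    (B : set (R * R)) : \bar R :=
  (\int[grid_measure delta]_(t in grid delta)
     (C%:E * exp_intensity (xsection B t)))%E.

Definition m3_process (R : realType) (T : Type)
    (Z : T -> nat -> R * R) (G : nat -> T -> R -> R) (w : T) (t : R) : \bar R :=
  ereal_sup (range (fun i => (G i w (t - (Z w i).1) + (Z w i).2)%:E)).

Definition m3_representation (R : realType) (delta : {nonneg R})
    (d : measure_display) (T : measurableType d) (P : probability T R)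
    (xi : T -> R -> \bar R) (C : R) : Prop :=
  exists (d0 : measure_display) (T0 : measurableType d0)
    (P0 : probability T0 R) (F : T0 -> R -> R)
    (d1 : measure_display) (T1 : measurableType d1)
    (P1 : probability T1 R) (Z : T1 -> nat -> R * R) (G : nat -> T1 -> R -> R),
  (shape_process delta F /\
   {ae P0, forall w,
      ereal_sup [set (F w t)%:E | t in grid delta] = 0%E /\ F w 0 = 0} /\
   0 < C /\ C%:E = m3_constant delta P0 F) /\
  (poisson_point_process P1 (@m3_intensity R delta C) Z /\
   (forall w i, grid delta (Z w i).1) /\
   (forall i, shape_process delta (G i)) /\
   independent_copies (grid delta) P0 F P1 Z G) /\
  same_law (grid delta) P xi P1 (m3_process Z G).

(* The limit is that of [\bar R]; [lim] is [0] if it does not exist. *)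
Definition pickands (R : realType) (delta : {nonneg R})
    (d : measure_display) (T : measurableType d) (P : probability T R)
    (W : T -> R -> R) : \bar R :=
  lim (((t^-1)%:E * \int[P]_w
    ereal_sup [set (expR (W w s))%:E | s in grid delta `&` `[0%R, t]])%E
      @[t --> (+oo)%R]).

Definition sup_exp (R : realType) (delta : {nonneg R}) (f : R -> R) : \bar R :=
  ereal_sup [set (expR (f t))%:E | t in grid delta].

Definition int_exp (R : realType) (delta : {nonneg R}) (f : R -> R) : \bar R :=
  (if delta%:num == 0%R then \int[lebesgue_measure]_t (expR (f t))%:E
   else delta%:num%:E * \esum_(t in grid delta) (expR (f t))%:E)%E.

(* Main.v *)
Require Import Defs.
From HB Require Import structures.
From mathcomp Require Import all_boot all_order all_algebra finmap.
From mathcomp Require Import all_classical all_reals all_analysis measurable_realfun.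
From mathcomp Require Import ring lra.
Set Implicit Arguments.
Unset Strict Implicit.
Unset Printing Implicit Defensive.
Import Order.TTheory GRing.Theory Num.Theory.
Import numFieldNormedType.Exports.
Local Open Scope classical_set_scope.
Local Open Scope ring_scope.

(* Let [e] be the intensity [exp(-x)dx]. The void probabilities of the two marked
   Poisson constructions show that the exponent measures, namely the image of
   [e \x P] under [(p, w) |-> p + W w] and the image of [C nu \x e \x P0] under
   [(s, q, w) |-> F w (. - s) + q], agree on the sets of paths [f] such that
   [f t_j > x_j] for some [j]; hence they agree on all events inside [f 0 > 0],
   where they are finite. The functional [sup exp f / int exp f] is invariant under
   time shifts and under the addition of constants. Its integral over [f 0 > 0] is
   [E(M / S)] for the first measure, because [W 0 = 0], and [C E(S_F^-1 S_F) = C]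
   for the second, [S_F] being the integral of [exp F].
   The event that [f > 0] somewhere on [grid & [0, T]] has first measure
   [E sup exp W], and second measure at least [C nu [0, T] >= C T], by considering
   only the shapes with their peak in the window and [q > 0]. By stationarity
   [E sup exp W] is subadditive in [T], so it has a growth rate, at least [C]. *)

(** * Integrating out an independent mark *)

(** No point process of paths is ever built: each side is reduced to a deterministic product
    measure, and the void probabilities determine its mass because [expeR] is injective. The
    intensity [exp(-x)dx] drives both computations. The levels [q] with [q + a > 0] have mass
    [exp a], so cutting at [f 0 > 0] weights a path of the first measure by [exp (W 0) = 1], and a
    shape of the second, moved to [s], by [exp (F (- s))], whose integral over [s] is [S_F]. The
    obstacle is measurability. Laws are known on the product sigma-algebra only, for which, when
    [delta = 0], neither evaluation at a variable time nor the supremum nor the integral of a path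
    is measurable. Evaluation is therefore replaced by a limit superior along rational multiples of
    the time grid [1 / n.+1], and suprema by suprema over countable sets of times; right-continuity
    makes both agree with the originals on the paths that occur. *)

Section indep_integral.
Local Open Scope ereal_scope.
Context (R : realType) (d d0 dK : measure_display).
Context (T : measurableType d) (P : probability T R).
Context (T0 : measurableType d0) (P0 : probability T0 R).
Context (K : measurableType dK).
Variables (Pi : set (set T)) (Y : T -> K) (X : T0 -> K).
Hypothesis mY : measurable_fun setT Y.
Hypothesis mX : measurable_fun setT X.
Hypothesis Pim : Pi `<=` measurable.
Hypothesis PiI : setI_closed Pi.
Hypothesis PiT : Pi setT.
Hypothesis indep : forall B C, Pi B -> measurable C ->
  P (B `&` Y @^-1` C) = P B * P0 (X @^-1` C).

Let TF := g_sigma_algebraType Pi.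

Let PiS : <<s Pi >> `<=` @measurable _ T.
Proof. by apply: smallest_sub => //; exact: sigma_algebra_measurable. Qed.

Let mid : measurable_fun setT (id : T -> TF).
Proof. by move=> _ B mB; rewrite setTI; exact: PiS. Qed.

Let mpair : measurable_fun setT (fun w : T => (w : TF, Y w)).
Proof. exact: measurable_fun_pair. Qed.

Let indepS B C : <<s Pi >> B -> measurable C ->
  P (B `&` Y @^-1` C) = P B * P0 (X @^-1` C).
Proof.
move=> sB mC.
have mYC : measurable (Y @^-1` C) by rewrite -[X in measurable X]setTI; exact: mY.
have c0 : (0 <= fine (P0 (X @^-1` C)))%R by rewrite fine_ge0.
have mXC : measurable (X @^-1` C) by rewrite -[X in measurable X]setTI; exact: mX.
have cE : P0 (X @^-1` C) = (NngNum c0)%:num%:E by rewrite fineK// fin_num_measure.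
(* For fixed [C], both sides are finite measures in [B]: the restriction of [P] to [Y @^-1]
   C[, and]P[scaled by the constant]P0 (X @^-1[C)]. *)
have := @g_sigma_algebra_measure_unique _ R T Pi Pim (fun=> setT) (fun=> PiT) _
  (mrestr P mYC) (mscale (NngNum c0) P).
move=> /(_ _ PiI _ _ B sB) H.
rewrite cE muleC; apply: H.
- by apply/seteqP; split => // x _; exists 0%N.
- move=> A PA; change (P (A `&` Y @^-1` C) = (NngNum c0)%:num%:E * P A).
  by rewrite -cE muleC; exact: indep.
- move=> k; apply: (@le_lt_trans _ _ (P setT)); last first.
    by rewrite probability_setT ltry.
  by apply: le_measure => //; rewrite inE//; exact: measurableI.
Qed.

(** Independence extends from the pi-system [Pi] to the sigma-algebra it generates, so the law of
    [(id, Y)] is a product and Tonelli applies. Giving the first factor the smaller sigma-algebra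
    lets [f] depend on everything observed so far. *)
Lemma indep_integral (f : TF * K -> \bar R) :
  measurable_fun setT f -> (forall z, 0 <= f z) ->
  \int[P]_w f (w, Y w) = \int[P]_w \int[P0]_x f (w, X x).
Proof.
move=> mf f0.
pose mX' := isMeasurableFun.Build _ _ _ _ X mX.
pose X' : {mfun T0 >-> K} := HB.pack X mX'.
pose mid' := isMeasurableFun.Build _ _ _ _ (id : T -> TF) mid.
pose I' : {mfun T >-> TF} := HB.pack (id : T -> TF) mid'.
pose mp' := isMeasurableFun.Build _ _ _ _ (fun w : T => (w : TF, Y w)) mpair.
pose Z' : {mfun T >-> (TF * K)%type} := HB.pack (fun w : T => (w : TF, Y w)) mp'.
transitivity (\int[distribution P Z']_z f z).
  by rewrite ge0_integral_distribution.
transitivity (\int[distribution P I' \x distribution P0 X']_z f z).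
  apply: eq_measure_integral => A mA _.
  by apply/esym/product_measure_unique.
rewrite fubini_tonelli1// /fubini_F ge0_integral_distribution//=.
- apply: eq_integral => w _; rewrite ge0_integral_distribution//.
  exact/measurableT_comp.
- exact: (measurable_fun_fubini_tonelli_F f).
- by move=> y; apply: integral_ge0.
Qed.

End indep_integral.

Section cap_system.
Context (T : Type) (I : choiceType).
Implicit Types (J : {fset I}) (G : I -> set (set T)).

(** When the [G i] are pi-systems containing the whole space, this is a pi-system generating the
    joint information of the indices in [J]; the product formula of [independent] separates it from
    any further index. *)
Definition cap_system J G : set (set T) :=
  [set B | exists2 E : I -> set T, (forall i, i \in J -> G i (E i)) &
    B = \bigcap_(i in [set` J]) E i].

Lemma cap_systemT J G : (forall i, G i setT) -> cap_system J G setT.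
Proof.
move=> GT; exists (fun=> setT) => //.
by apply/esym; rewrite -subTset => x _ i _.
Qed.

Lemma cap_systemI J G : (forall i, setI_closed (G i)) ->
  setI_closed (cap_system J G).
Proof.
move=> GI _ _ [E GE ->] [F GF ->]; exists (fun i => E i `&` F i).
  by move=> i iJ; apply: GI; [exact: GE|exact: GF].
by rewrite bigcapI.
Qed.

Lemma sub_cap_system J G j : (forall i, G i setT) -> j \in J ->
  G j `<=` cap_system J G.
Proof.
move=> GT jJ B GB; exists (fun i => if i == j then B else setT).
  by move=> i _; case: eqP => [->|].
apply/seteqP; split=> [x Bx i _ /=|x /(_ j jJ)]; first by case: eqP.
by rewrite eqxx.
Qed.

End cap_system.

Section independent_cap_system.
Context (R : realType) (d : measure_display) (T : measurableType d)
  (P : probability T R) (I : choiceType).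
Implicit Types (J : {fset I}) (G : I -> set (set T)).

Lemma cap_system_measurable J G : (forall i, G i `<=` measurable) ->
  cap_system J G `<=` measurable.
Proof.
move=> Gm _ [E GE ->]; apply: fin_bigcap_measurable => //.
by move=> i iJ; apply/Gm/GE.
Qed.

Lemma independent_cap_system J G i B C : independent P G -> i \notin J ->
  cap_system J G B -> G i C -> (P (B `&` C) = P B * P C)%E.
Proof.
move=> indG iJ [E GE ->] GC.
pose E' j := if j == i then C else E j.
have E'E j : j \in J -> E' j = E j.
  by move=> jJ; rewrite /E'; case: eqP => // ji; rewrite -ji jJ in iJ.
have GE' j : j \in (i |` J)%fset -> G j (E' j).
  rewrite !inE => /orP[/eqP ->|jJ]; first by rewrite /E' eqxx.
  by rewrite E'E//; exact: GE.
have -> : \bigcap_(j in [set` J]) E j `&` C =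
    \bigcap_(j in [set` (i |` J)%fset]) E' j.
  apply/seteqP; split=> [x [Ex Cx] j|x E'x].
    rewrite /= !inE => /orP[/eqP ->|jJ]; first by rewrite /E' eqxx.
    by rewrite E'E//; exact: Ex.
  split=> [j jJ|]; first by rewrite -E'E//; apply: E'x; rewrite /= !inE jJ orbT.
  by have := E'x i; rewrite /E' eqxx; apply; rewrite /= !inE eqxx.
rewrite (indG _ _ GE') big_fsetU1//= muleC /E' eqxx; congr (_ * _)%E.
rewrite indG//; rewrite !big_seq; apply: eq_bigr => j jJ.
by rewrite -/(E' j) E'E.
Qed.

End independent_cap_system.

Section preimage_systems.
Context (d d' : measure_display) (T : measurableType d) (K : measurableType d').
Implicit Types f : T -> K.

Lemma preimage_systemT f : preimage_set_system setT f measurable setT.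
Proof. by exists setT => //; rewrite setTI preimage_setT. Qed.

Lemma preimage_systemI f : setI_closed (preimage_set_system setT f measurable).
Proof.
move=> _ _ [B mB <-] [C mC <-]; exists (B `&` C); first exact: measurableI.
by rewrite !setTI preimage_setI.
Qed.

Lemma preimage_system_measurable f : measurable_fun setT f ->
  preimage_set_system setT f measurable `<=` measurable.
Proof. by move=> mf _ [B mB <-]; exact: mf. Qed.

Lemma measurable_fun_sub (Pi : set (set T)) f :
  preimage_set_system setT f measurable `<=` Pi ->
  measurable_fun setT (f : g_sigma_algebraType Pi -> K).
Proof.
move=> sub _ B mB; apply: sub_sigma_algebra; apply: sub.
by exists B.
Qed.

End preimage_systems.

Section marked_product.
Context (R : realType) (d dZ dE dK d0 : measure_display).
Context (T : measurableType d) (P : probability T R).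
Context (T0 : measurableType d0) (P0 : probability T0 R).
Context (KZ : measurableType dZ) (E : measurableType dE) (K : measurableType dK).
Variables (Z : T -> KZ) (e : nat -> KZ -> E) (Y : nat -> T -> K) (X : T0 -> K).
Hypothesis mZ : measurable_fun setT Z.
Hypothesis me : forall i, measurable_fun setT (e i).
Hypothesis mY : forall i, measurable_fun setT (Y i).
Hypothesis mX : measurable_fun setT X.
Hypothesis lawY : forall i C, measurable C -> P (Y i @^-1` C) = P0 (X @^-1` C).

Let G (o : option nat) : set (set T) :=
  if o is Some i then preimage_set_system setT (Y i) measurable
  else preimage_set_system setT Z measurable.

Hypothesis indG : independent P G.

Variable A : set (E * K).
Hypothesis mA : measurable A.

Definition mark_prob (z : E) : R := fine (P0 [set x | A (z, X x)]).

Let mark_probE z : (mark_prob z)%:E = P0 [set x | A (z, X x)].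
Proof.
rewrite /mark_prob fineK// fin_num_measure//.
rewrite -[X in measurable X]setTI.
have := measurable_xsection z mA.
by rewrite xsectionE => /(mX measurableT).
Qed.

Lemma mark_prob_ge0 z : 0 <= mark_prob z.
Proof. by rewrite -lee_fin mark_probE. Qed.

Lemma mark_prob_le1 z : mark_prob z <= 1.
Proof.
rewrite -lee_fin mark_probE probability_le1//.
rewrite -[X in measurable X]setTI.
have := measurable_xsection z mA.
by rewrite xsectionE => /(mX measurableT).
Qed.

Lemma measurable_mark_prob : measurable_fun setT mark_prob.
Proof.
have mX2 : measurable_fun setT (fun zx : E * T0 => (zx.1, X zx.2)).
  by apply: measurable_fun_pair => //; exact: measurableT_comp.
have := measurable_fun_xsection P0 (mX2 measurableT A mA).
rewrite setTI => m1.
rewrite (_ : mark_prob = fine \o (P0 \o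
    xsection ((fun zx : E * T0 => (zx.1, X zx.2)) @^-1` A))).
  exact: measurableT_comp.
by apply/funext => z; rewrite /= xsectionE.
Qed.

Let mind : measurable_fun setT (\1_A : E * K -> R).
Proof. exact: measurable_indic. Qed.

Let sysT o : G o setT.
Proof. by case: o => [i|]; exact: preimage_systemT. Qed.

Let sysI o : setI_closed (G o).
Proof. by case: o => [i|]; exact: preimage_systemI. Qed.

Let sysm o : G o `<=` measurable.
Proof. by case: o => [i|]; exact: preimage_system_measurable. Qed.

Let past m : {fset option nat} :=
  [fset o in None :: [seq Some i | i <- iota 0 m]]%fset.

Let past_None m : None \in past m.
Proof. by rewrite !inE. Qed.

Let past_Some m i : (Some i \in past m) = (i < m)%N.
Proof. by rewrite !inE/= mem_map ?mem_iota ?add0n// => x y [->]. Qed.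

(* Given the points and the first [m] marks, the mark [Y m] has the law of [X],
   so integrating it out replaces its indicator by [mark_prob]. *)
Lemma marked_product m (h : KZ -> R) :
  measurable_fun setT h -> (forall z, 0 <= h z) ->
  (\int[P]_w (h (Z w) * \prod_(i < m) \1_A (e i (Z w), Y i w))%:E =
   \int[P]_w (h (Z w) * \prod_(i < m) mark_prob (e i (Z w)))%:E)%E.
Proof.
(* [h] must vary: once [Y m] is integrated out, its factor [mark_prob (e m _)] depends on the points
   alone and is absorbed into [h]. *)
elim: m h => [|m IH] h mh h0; first by apply: eq_integral => w _; rewrite !big_ord0.
pose Pi := cap_system (past m) G.
pose TF := g_sigma_algebraType Pi.
have mZF : measurable_fun setT (Z : TF -> KZ).
  by apply: measurable_fun_sub; apply: (@sub_cap_system _ _ (past m) G None).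
have mYF i : (i < m)%N -> measurable_fun setT (Y i : TF -> K).
  move=> im; apply: measurable_fun_sub.
  by apply: (@sub_cap_system _ _ (past m) G (Some i)) => //; rewrite past_Some.
pose a (w : T) := h (Z w) * \prod_(i < m) \1_A (e i (Z w), Y i w).
have ma : measurable_fun setT (a : TF -> R).
  apply: measurable_funM; first exact: measurableT_comp.
  apply: measurable_prod => i _.
  apply: (measurableT_comp mind).
  apply: measurable_fun_pair; last exact: mYF.
  exact: (measurableT_comp (me i)).
have a0 w : 0 <= a w by rewrite mulr_ge0// prodr_ge0.
pose f (wy : TF * K) : \bar R := (a wy.1 * \1_A (e m (Z wy.1), wy.2))%:E.
have mf : measurable_fun setT f.
  apply/measurable_EFinP/measurable_funM.
    exact: (measurableT_comp ma).
  apply: (measurableT_comp mind).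
  apply: measurable_fun_pair => //.
  apply: (measurableT_comp (me m)).
  exact: (measurableT_comp mZF).
transitivity (\int[P]_w f (w, Y m w))%E.
  by apply: eq_integral => w _; rewrite /f/= big_ord_recr/= mulrA.
rewrite (@indep_integral R d d0 dK T P T0 P0 K Pi (Y m) X)//.
- transitivity (\int[P]_w
      ((fun z => h z * mark_prob (e m z)) (Z w) *
        \prod_(i < m) \1_A (e i (Z w), Y i w))%:E)%E.
    apply: eq_integral => w _; rewrite /f/=.
    under eq_integral do rewrite EFinM.
    rewrite ge0_integralZl_EFin//; last first.
      apply/measurable_EFinP/(measurableT_comp mind).
      exact: measurable_fun_pair.
    rewrite -[LHS]/(_ * \int[P0]_x (\1_[set x | A (e m (Z w), X x)] x)%:E)%E.
    rewrite integral_indic//; last first.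
      rewrite -[X in measurable X]setTI.
      apply: (@measurable_fun_pair _ _ _ _ _ _ (cst (e m (Z w))) X) => //.
    rewrite setIT; transitivity ((a w)%:E * (mark_prob (e m (Z w)))%:E)%E.
      by congr (_ * _)%E; exact/esym/mark_probE.
    by rewrite -EFinM /a mulrAC.
  etransitivity; first apply: (IH (fun z => h z * mark_prob (e m z))).
  + apply: measurable_funM => //; apply: measurableT_comp => //.
    exact: measurable_mark_prob.
  + by move=> z; rewrite mulr_ge0// mark_prob_ge0.
  + apply: eq_integral => w _.
    by rewrite big_ord_recr/= -mulrA (mulrC (mark_prob _)).
- exact: cap_system_measurable.
- exact: cap_systemI.
- exact: cap_systemT.
- move=> B C PB mC; rewrite (independent_cap_system indG _ PB (i := Some m)).
  + by rewrite lawY.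
  + by rewrite past_Some ltnn.
  + by exists C => //; rewrite setTI.
- by move=> z; rewrite lee_fin mulr_ge0.
Qed.

End marked_product.

(** * Laplace functional of a Poisson process *)

Lemma integral_probability_cst (R : realType) (d : measure_display)
  (T : measurableType d) (P : probability T R) (c : \bar R) :
  (\int[P]_w c = c)%E.
Proof. by rewrite integral_cst//= probability_setT mule1. Qed.

Section independent_product.
Local Open Scope ereal_scope.
Context (R : realType) (d dK : measure_display) (T : measurableType d)
  (P : probability T R) (K : measurableType dK) (I : choiceType).
Variables (N : I -> T -> K) (phi : I -> K -> R).
Hypothesis mN : forall i, measurable_fun setT (N i).
Hypothesis mphi : forall i, measurable_fun setT (phi i).
Hypothesis phi0 : forall i x, (0 <= phi i x)%R.
Hypothesis indN :
  independent P (fun i => preimage_set_system setT (N i) measurable).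

(** One factor is split off at a time by [indep_integral], with [N i] as both [Y] and [X]; the
    remaining product is measurable for the [cap_system] of the other indices. *)
Lemma independent_product (s : seq I) : uniq s ->
  \int[P]_w (\prod_(i <- s) phi i (N i w))%R%:E =
  \prod_(i <- s) \int[P]_w (phi i (N i w))%:E.
Proof.
elim: s => [_|i s IH /= /andP[is_ us]].
  rewrite big_nil; under eq_integral do rewrite big_nil.
  exact: integral_probability_cst.
pose G := fun i => preimage_set_system setT (N i) measurable.
pose J := [fset j in s]%fset.
pose Pi := cap_system J G.
have GT j : G j setT by exact: preimage_systemT.
pose a (w : T) := (\prod_(j <- s) phi j (N j w))%R.
have ma : measurable_fun setT (a : g_sigma_algebraType Pi -> R).
  apply: measurable_prod => j js.
  apply: (measurableT_comp (mphi j)); apply: measurable_fun_sub.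
  by apply: (@sub_cap_system _ _ J G j) => //; rewrite !inE.
have a0 w : (0 <= a w)%R by exact: prodr_ge0.
pose f (wy : g_sigma_algebraType Pi * K) : \bar R :=
  (a wy.1 * phi i wy.2)%:E.
have mf : measurable_fun setT f.
  by apply/measurable_EFinP/measurable_funM; exact: measurableT_comp.
transitivity (\int[P]_w f (w, N i w)).
  by apply: eq_integral => w _; rewrite big_cons mulrC.
rewrite (@indep_integral R d d dK T P T P K Pi (N i) (N i))//.
- rewrite /f/= big_cons -IH// muleC.
  have mphiN : measurable_fun setT (fun w => (phi i (N i w))%:E).
    by apply/measurable_EFinP; exact: measurableT_comp.
  have ma' : measurable_fun setT (fun w => (a w)%:E).
    apply/measurable_EFinP; apply: measurable_prod => j _.
    exact: measurableT_comp.
  have i0 : 0 <= \int[P]_w (phi i (N i w))%:E.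
    by apply: integral_ge0 => w _; rewrite lee_fin.
  have a0' w : [set: T] w -> 0 <= (a w)%:E by rewrite lee_fin.
  rewrite -(ge0_integralZr _ _ ma')//.
  apply: eq_integral => w _; under eq_integral do rewrite EFinM.
  by rewrite ge0_integralZl_EFin// => x _; rewrite lee_fin.
- by apply: cap_system_measurable => j; exact: preimage_system_measurable.
- by apply: cap_systemI => j; exact: preimage_systemI.
- exact: cap_systemT.
- move=> B C PB mC; rewrite (independent_cap_system indN _ PB (i := i))//.
  + by rewrite !inE.
  + by exists C => //; rewrite setTI.
- by move=> z; rewrite lee_fin mulr_ge0.
Qed.

End independent_product.

Lemma nneseries_expR (R : realType) (c x : R) : 0 <= c -> 0 <= x ->
  (\sum_(0 <= k <oo) (c * (x ^+ k / k`!%:R))%:E = (c * expR x)%:E)%E.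
Proof.
move=> c0 x0; under eq_eseriesr do rewrite EFinM.
rewrite nneseriesZl/=; last by move=> n _; rewrite lee_fin divr_ge0// exprn_ge0.
rewrite EFinM; congr *%E; rewrite /expR -EFin_lim; last first.
  exact: is_cvg_series_exp_coeff.
by apply/congr_lim/funext => n/=; rewrite /series/= -sumEFin.
Qed.

(** The power of [r] with exponent a possibly infinite count: for [r] in [[0, 1]], the value at
    [+oo] is the limit of [r ^+ n]. *)
Definition count_pow (R : realType) (r : R) (x : \bar R) : R :=
  if x == +oo%E then (r == 1)%:R else powR r (fine x).

Section count_pow.
Context (R : realType).
Implicit Types r : R.

Lemma count_pow_nat r k : 0 <= r -> count_pow r k%:R%:E = r ^+ k.
Proof. by move=> r0; rewrite /count_pow/= powR_mulrn. Qed.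

Lemma count_pow_y r : count_pow r +oo = (r == 1)%:R.
Proof. by rewrite /count_pow eqxx. Qed.

Lemma count_pow_ge0 r x : 0 <= count_pow r x.
Proof. by rewrite /count_pow; case: ifP => _ //; exact: powR_ge0. Qed.

Lemma measurable_count_pow r : measurable_fun setT (count_pow r).
Proof.
apply: measurable_fun_ifT => //; last first.
  exact: (measurableT_comp (measurable_powRr r)).
apply: (measurable_fun_bool true); rewrite setTI.
rewrite (_ : _ @^-1` _ = [set +oo%E]); first exact: emeasurable_set1.
by apply/seteqP; split => x /= /eqP.
Qed.

End count_pow.

Section poisson_counts.
Local Open Scope ereal_scope.
Context (R : realType) (d d' : measure_display) (T : measurableType d)
  (P : probability T R) (E : measurableType d')
  (mu : {measure set E -> \bar R}) (Z : T -> nat -> E).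
Hypothesis ppp : poisson_point_process P mu Z.

Lemma measurable_count (B : set E) : measurable B ->
  measurable_fun setT (fun w => point_measure R Z w B).
Proof.
move=> mB; case: ppp => mZ _ _ _.
apply: ge0_emeasurable_sum => // i _.
by apply: (measurableT_comp (f := fun x => \d_x B)) => //; exact: measurable_fun_dirac.
Qed.

Lemma integral_count_pow (B : set E) (r : R) : measurable B ->
  (0 <= r <= 1)%R ->
  \int[P]_w (count_pow r (point_measure R Z w B))%:E =
  expeR (- ((1 - r)%:E * mu B)).
Proof.
move=> mB /andP[r0 r1]; have mN := measurable_count mB.
have mf : measurable_fun setT (fun w => (count_pow r (point_measure R Z w B))%:E).
  apply/measurable_EFinP; apply: measurableT_comp => //.
  exact: measurable_count_pow.
have f0 w : 0 <= (count_pow r (point_measure R Z w B))%:E.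
  by rewrite lee_fin count_pow_ge0.
case: ppp => _ fin inf _.
have [mBy|mBNy] := eqVneq (mu B) +oo.
  rewrite mBy; transitivity (\int[P]_w (cst (r == 1)%:R%:E w)).
    apply: ge0_ae_eq_integral => //.
      by move=> w _; rewrite lee_fin ler0n.
    move: (inf B mB mBy); apply: filterS => w wy _.
    by rewrite wy count_pow_y.
  rewrite integral_probability_cst.
  (* For [r = 1] the exponent is [0 * +oo = 0], in accordance with [count_pow 1 +oo = 1]. *)
  have [->|rN1] := eqVneq r 1%R; first by rewrite subrr mul0e oppe0 expeR0.
  by rewrite gt0_muley// lte_fin subr_gt0 lt_neqAle rN1.
pose l := fine (mu B).
have mBl : mu B = l%:E by rewrite fineK// ge0_fin_numE// ltey.
have l0 : (0 <= l)%R by rewrite fine_ge0.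
rewrite mBl.
pose A k := [set w | point_measure R Z w B = k%:R%:E].
have mA k : measurable (A k).
  rewrite -[X in measurable X]setTI.
  by apply: (mN measurableT [set k%:R%:E]).
have tA : trivIset setT A.
  apply/trivIsetP => i j _ _ ij; apply/seteqP; split => // w [/= Ai].
  by rewrite /A/= Ai => -[] /eqP; rewrite eqr_nat (negbTE ij).
have PA k : P (A k) = (expR (- l) * (l ^+ k / k`!%:R))%:E.
  by rewrite /A (fin _ l)// mulrA.
have mU : measurable (\bigcup_k A k) by exact: bigcupT_measurable.
(* The Poisson weights sum to 1, so the count is almost surely a natural number and the integral is
   the power series of the generating function. *)
have PU : P (~` \bigcup_k A k) = 0.
  rewrite probability_setC//.
  have -> : P (\bigcup_k A k) = \sum_(0 <= k <oo) P (A k).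
    by apply/esym/cvg_lim => //; exact: measure_semi_sigma_additive.
  rewrite (eq_eseriesr (fun k _ => PA k)).
  rewrite nneseries_expR ?expR_ge0// -expRD addNr expR0.
  by rewrite subee.
rewrite (ge0_negligible_integral (measurableC mU))// setTD setCK.
rewrite ge0_integral_bigcup//; last exact: measurable_funS mf.
rewrite (eq_eseriesr (g := fun k => (expR (- l) * ((r * l) ^+ k / k`!%:R))%:E)).
  rewrite nneseries_expR ?expR_ge0 ?mulr_ge0// -expRD -EFinM/=.
  by congr (expR _)%:E; ring.
move=> k _; rewrite (eq_integral (cst (r ^+ k)%:E)); last first.
  by move=> w /[!inE] /= ->; rewrite count_pow_nat.
by rewrite integral_cst//= PA -EFinM exprMn; rewrite mulrCA !mulrA.
Qed.

End poisson_counts.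

Lemma bounded_cvg_integral (R : realType) (d : measure_display)
    (T : measurableType d) (P : probability T R) (f_ : nat -> T -> R)
    (f : T -> R) :
  (forall n, measurable_fun setT (f_ n)) ->
  (forall n w, 0 <= f_ n w <= 1) ->
  (forall w, f_ n w @[n --> \oo] --> f w) ->
  (\int[P]_w (f_ n w)%:E @[n --> \oo] --> \int[P]_w (f w)%:E)%E.
Proof.
move=> mf_ f01 f_f.
have mf : measurable_fun setT f.
  by apply: (measurable_fun_cvg (h := f_)) => // w _; exact: f_f.
have [] := @dominated_convergence _ _ _ P setT measurableT
  (fun n w => (f_ n w)%:E) (fun w => (f w)%:E) (cst 1%E) => //.
- by move=> n; exact/measurable_EFinP.
- exact/measurable_EFinP.
- by apply: aeW => w _; apply: cvg_EFin; [exact: nearW|exact: f_f].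
- exact: finite_measure_integrable_cst.
- apply: aeW => w n _; have /andP[f0 f1] := f01 n w.
  by rewrite gee0_abs lee_fin.
Qed.

(** A nondecreasing sequence of naturals is either eventually constant or divergent; the value of
    [count_pow] at [+oo] serves the second case. *)
Lemma cvg_count_pow (R : realType) (r : R) (u : nat -> nat) (L : \bar R) :
  0 <= r <= 1 -> nondecreasing_seq u ->
  (u n)%:R%:E @[n --> \oo] --> L -> r ^+ u n @[n --> \oo] --> count_pow r L.
Proof.
move=> /andP[r0 r1] ndu uL.
have [[M uM]|uoo] := pselect (exists M, forall n, (u n <= M)%N).
  pose Q k := `[< exists n, u n = k >].
  have exQ : exists k, Q k by exists (u 0%N); apply/asboolP; exists 0%N.
  have QM k : Q k -> (k <= M)%N by move=> /asboolP[n <-].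
  have [k /asboolP[n0 n0k] kmax] := ex_maxnP exQ QM.
  have uk : \forall n \near \oo, u n = k.
    near=> n; apply/eqP; rewrite eqn_leq kmax ?andTb; last first.
      by apply/asboolP; exists n.
    rewrite -n0k; apply: ndu; near: n; exact: nbhs_infty_ge.
  have -> : L = k%:R%:E.
    rewrite -(cvg_lim _ uL)//; apply/cvg_lim => //.
    by apply: cvg_near_cst; near=> n; rewrite (near uk n).
  rewrite count_pow_nat//.
  by apply: cvg_near_cst; near=> n; rewrite (near uk n).
have uy : u @ \oo --> \oo.
  apply/cvgnyPge => M; have [n0 Mn0] : exists n, (M <= u n)%N.
    apply: contrapT => /forallNP nM; apply: uoo; exists M => n.
    by rewrite leqNgt; apply/negP => /ltnW; exact: nM.
  near=> n; rewrite (leq_trans Mn0)//; apply: ndu; near: n.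
  exact: nbhs_infty_ge.
have -> : L = +oo%E.
  by rewrite -(cvg_lim _ uL)//; apply/cvg_lim => //; exact/cvgenyP.
rewrite count_pow_y; have [->|rN1] := eqVneq r 1.
  by under eq_fun do rewrite expr1n; exact: cvg_cst.
apply: (cvg_comp _ _ uy); apply: cvg_expr.
by rewrite ger0_norm// lt_neqAle rN1.
Unshelve. all: by end_near. Qed.

Lemma cvg_prodr (R : realType) (I : Type) (s : seq I) (f : I -> nat -> R)
    (l : I -> R) : (forall i, f i n @[n --> \oo] --> l i) ->
  \prod_(i <- s) f i n @[n --> \oo] --> \prod_(i <- s) l i.
Proof.
move=> fl; elim: s => [|i s IH].
  by rewrite big_nil; under eq_fun do rewrite big_nil; exact: cvg_cst.
rewrite big_cons; under eq_fun do rewrite big_cons.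
exact: cvgM.
Qed.

Section laplace.
Local Open Scope ereal_scope.
Context (R : realType) (d d' : measure_display) (T : measurableType d)
  (P : probability T R) (E : measurableType d')
  (mu : {measure set E -> \bar R}) (Z : T -> nat -> E).
Hypothesis ppp : poisson_point_process P mu Z.
Import HBNNSimple.

Let mZ i : measurable_fun setT (fun w => Z w i).
Proof. by case: ppp. Qed.

Let prod01 (G : E -> R) m w : (forall x, 0 <= G x <= 1)%R ->
  (0 <= \prod_(i < m) G (Z w i) <= 1)%R.
Proof.
move=> G01; apply: (@big_ind _ (fun x : R => (0 <= x <= 1)%R)) => //; first by rewrite ler01 lexx.
by move=> x y /andP[x0 x1] /andP[y0 y1]; rewrite mulr_ge0//= mulr_ile1.
Qed.

Let mprod (G : E -> R) m : measurable_fun setT G ->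
  measurable_fun setT (fun w => \prod_(i < m) G (Z w i))%R.
Proof. by move=> mG; apply: measurable_prod => i _; exact: measurableT_comp. Qed.

Let count (B : set E) m w : nat := (\sum_(i < m) (Z w i \in B))%N.

Let cvg_count B w :
  (count B m w)%:R%:E @[m --> \oo] --> point_measure R Z w B.
Proof.
rewrite (_ : (fun m => _) = (fun m => \sum_(0 <= i < m) (\d_(Z w i) B : \bar R))).
  by apply: is_cvg_nneseries.
apply/funext => m; rewrite /count natr_sum -sumEFin big_mkord.
by apply: eq_bigr => i _; rewrite diracE.
Qed.

Let nd_count B w : nondecreasing_seq (fun m => count B m w).
Proof.
apply/nondecreasing_seqP => m.
by rewrite /count big_ord_recr/= leEnat leq_addr.
Qed.

(** Grouping the points by the value of [h] turns the product into powers of [1 - a k], whose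
    exponents count the points in the disjoint level sets of [h]. These counts are independent, and
    each has a known generating function. *)
Let laplace_nnsfun (h : {nnsfun E >-> R}) : (forall x, h x <= 1)%R ->
  \int[P]_w (\prod_(i < m) (1 - h (Z w i)))%R%:E @[m --> \oo] -->
  expeR (- \int[mu]_x (h x)%:E).
Proof.
move=> h1; have h0 x : (0 <= h x)%R by exact: fun_ge0.
pose s : seq R := fset_set (range h).
pose n := size s.
pose a (k : 'I_n) := tnth (in_tuple s) k.
pose B (k : 'I_n) := h @^-1` [set a k].
have mB k : measurable (B k) by exact: measurable_sfunP.
have a01 k : (0 <= a k <= 1)%R.
  have : a k \in s by exact: mem_tnth.
  by rewrite in_fset_set// inE => -[x _ <-]; rewrite h1 fun_ge0.
have us : uniq s by exact: fset_uniq.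
have tB : trivIset setT B.
  apply/trivIsetP => i j _ _ ij; apply/seteqP; split => // x [/= hi].
  by rewrite /B/= hi => /eqP; rewrite /a !(tnth_nth 0%R)/= nth_uniq// => /eqP/val_inj/eqP;
    rewrite (negbTE ij).
have prodE w m : (\prod_(i < m) (1 - h (Z w i)) =
    \prod_(k < n) (1 - a k) ^+ count (B k) m w)%R.
  under [RHS]eq_bigr do rewrite /count expr_sum.
  rewrite exchange_big/=; apply: eq_bigr => i _.
  have hs : h (Z w i) \in s by rewrite in_fset_set// inE; exists (Z w i).
  have ks : (index (h (Z w i)) s < n)%N by rewrite index_mem.
  rewrite (bigD1 (Ordinal ks))//= big1 ?mulr1 => [|k kN].
    by rewrite mem_set ?expr1 /B /a/= (tnth_nth 0%R)/= nth_index.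
  rewrite memNset ?expr0// /B/= => hk; move/eqP: kN; apply.
  by apply/val_inj; rewrite /= hk /a (tnth_nth 0%R)/= index_uniq.
have cvgP w : (\prod_(i < m) (1 - h (Z w i)))%R @[m --> \oo] -->
    (\prod_(k < n) count_pow (1 - a k) (point_measure R Z w (B k)))%R.
  under eq_fun do rewrite prodE.
  apply: cvg_prodr => k; apply: cvg_count_pow; last exact: cvg_count.
  - by have := a01 k; lra.
  - exact: nd_count.
have -> : expeR (- \int[mu]_x (h x)%:E) = \int[P]_w
    (\prod_(k < n) count_pow (1 - a k) (point_measure R Z w (B k)))%R%:E.
  rewrite (@independent_product R d _ T P _ _
    (fun k w => point_measure R Z w (B k)) (fun k => count_pow (1 - a k))).
  - have -> : \int[mu]_x (h x)%:E = \sum_(k < n) (a k)%:E * mu (B k).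
      rewrite integralT_nnsfun sintegralE fsbig_finite//= (big_nth 0%R).
      rewrite big_mkord; apply: eq_bigr => k _.
      by rewrite /B /a (tnth_nth 0%R).
    have cE k : \int[P]_w
        (count_pow (1 - a k) (point_measure R Z w (B k)))%:E =
        expeR (- ((a k)%:E * mu (B k))).
      rewrite (integral_count_pow ppp)//; last by have := a01 k; lra.
      by rewrite subKr.
    rewrite (eq_bigr _ (fun k _ => cE k)).
    suff [] : 0 <= \sum_(k < n) (a k)%:E * mu (B k) /\
      expeR (- (\sum_(k < n) (a k)%:E * mu (B k))) =
      \prod_(k < n) expeR (- ((a k)%:E * mu (B k))) by [].
    elim/big_rec2 : _ => [|k y x _ [x0 <-]]; first by rewrite oppe0 expeR0.
    have ak0 : 0 <= (a k)%:E * mu (B k).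
      by rewrite mule_ge0// lee_fin; case/andP: (a01 k).
    by rewrite adde_ge0// oppeD ?expeRD// ge0_adde_def// inE.
  - by move=> k; exact: (measurable_count ppp).
  - by move=> k; exact: measurable_count_pow.
  - by move=> k x; exact: count_pow_ge0.
  - by case: ppp => _ _ _; apply.
  - exact: index_enum_uniq.
apply: (@bounded_cvg_integral _ _ _ _
  (fun m w => \prod_(i < m) (1 - h (Z w i)))%R) => //.
- move=> m; apply: (@mprod (fun x => 1 - h x)%R).
  by apply: measurable_funB => //.
- by move=> m w; apply: (@prod01 (fun x => 1 - h x)%R) => x; have := h1 x; have := h0 x; lra.
Qed.

(** The simple functions [h n] increase to [1 - G]. The limits in [n] and [m] are exchanged by
    monotonicity alone: [v m <= u n m] gives the upper bound, and [u n m] being at least its limit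
    in [m] gives a lower bound uniform in [n]. *)
Lemma poisson_laplace (G : E -> R) : measurable_fun setT G ->
  (forall x, 0 <= G x <= 1)%R ->
  \int[P]_w (\prod_(i < m) G (Z w i))%R%:E @[m --> \oo] -->
  expeR (- \int[mu]_x (1 - G x)%:E).
Proof.
move=> mG G01.
have mf : measurable_fun setT (fun x => (1 - G x)%:E).
  by apply/measurable_EFinP; exact: measurable_funB.
have f0 x : setT x -> 0 <= (1 - G x)%:E.
  by move=> _; have := G01 x; rewrite lee_fin; lra.
pose h := nnsfun_approx measurableT mf.
have hcvg x : h n x @[n --> \oo] --> (1 - G x)%R.
  have /fine_cvg := cvg_nnsfun_approx measurableT mf f0 (Logic.I : setT x).
  exact.
have hf n x : (h n x <= 1 - G x)%R.
  rewrite -(cvg_lim _ (hcvg x))//; apply: nondecreasing_cvgn_le.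
    by move=> i j ij; exact/lefP/nd_nnsfun_approx.
  by apply/cvg_ex; eexists; exact: hcvg.
have h0 n x : (0 <= h n x)%R by exact: fun_ge0.
have h1 n x : (h n x <= 1)%R.
  by have := hf n x; have := G01 x; lra.
have h01 n x : (0 <= 1 - h n x <= 1)%R.
  by have := h1 n x; have := h0 n x; lra.
pose u n m := \int[P]_w (\prod_(i < m) (1 - h n (Z w i)))%R%:E.
pose v m := \int[P]_w (\prod_(i < m) G (Z w i))%R%:E.
have uU n : u n m @[m --> \oo] --> expeR (- \int[mu]_x (h n x)%:E).
  exact: laplace_nnsfun.
have uv m : u n m @[n --> \oo] --> v m.
  apply: (@bounded_cvg_integral _ _ _ _
    (fun n w => \prod_(i < m) (1 - h n (Z w i)))%R) => //.
  - move=> n; apply: (@mprod (fun x => 1 - h n x)%R).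
    exact: measurable_funB.
  - by move=> n w; exact: (@prod01 (fun x => 1 - h n x)%R).
  - move=> w; apply: cvg_prodr => i.
    by rewrite -[G _](subKr 1%R); apply: cvgB; [exact: cvg_cst|exact: hcvg].
have ni_prod (H : E -> R) : measurable_fun setT H ->
    (forall x, 0 <= H x <= 1)%R ->
    nonincreasing_seq (fun m => \int[P]_w (\prod_(i < m) H (Z w i))%R%:E).
  move=> mH H01; apply/nonincreasing_seqP => m.
  apply: ge0_le_integral => //.
  - by move=> w _; rewrite lee_fin; case/andP: (prod01 m.+1 w H01).
  - exact/measurable_EFinP/mprod.
  - exact/measurable_EFinP/mprod.
  - move=> w _; rewrite lee_fin big_ord_recr/= ler_piMr//.
      by case/andP: (prod01 m w H01).
    by case/andP: (H01 (Z w m)).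
have v_cvg : cvgn v by apply: ereal_nonincreasing_is_cvgn; exact: ni_prod.
suff : limn v = expeR (- \int[mu]_x (1 - G x)%:E) by move=> <-.
have vu n m : v m <= u n m.
  apply: ge0_le_integral => //.
  - by move=> w _; rewrite lee_fin; case/andP: (prod01 m w G01).
  - exact/measurable_EFinP/mprod.
  - apply/measurable_EFinP/(@mprod (fun x => 1 - h n x)%R).
    exact: measurable_funB.
  - move=> w _; rewrite lee_fin; apply: ler_prod => i _.
    by have := hf n (Z w i); have := G01 (Z w i); lra.
have int_lim : \int[mu]_x (h n x)%:E @[n --> \oo] --> \int[mu]_x (1 - G x)%:E.
  have -> : \int[mu]_x (1 - G x)%:E = \int[mu]_x limn (fun n => (h n x)%:E).
    apply: eq_integral => x _; apply/esym/cvg_lim => //.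
    exact: (cvg_nnsfun_approx measurableT mf f0).
  apply: cvg_monotone_convergence => //.
  - by move=> n; exact/measurable_EFinP.
  - by move=> n x _; rewrite lee_fin.
  - by move=> x _ n m nm; rewrite lee_fin; exact/lefP/nd_nnsfun_approx.
apply/eqP; rewrite eq_le; apply/andP; split.
- have v0 : 0 <= limn v.
    apply: lime_ge => //; apply: nearW => m; apply: integral_ge0 => w _.
    by rewrite lee_fin; case/andP: (prod01 m w G01).
  (* Writing the limit as [expeR y] moves the bounds for all [n] into the exponent, where monotone
     convergence applies. *)
  have [y yE] := expeR_total v0.
  rewrite -yE lee_expeR leeNr.
  rewrite -(cvg_lim _ int_lim)//.
  apply: lime_le; first by apply/cvg_ex; eexists; exact: int_lim.
  apply: nearW => n; rewrite leeNr -lee_expeR yE.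
  rewrite -(cvg_lim _ (uU n))//.
  apply: lee_lim => //; first by apply/cvg_ex; eexists; exact: uU.
  exact: nearW.
- apply: lime_ge => //; apply: nearW => m.
  rewrite -(cvg_lim _ (uv m))//.
  apply: lime_ge; first by apply/cvg_ex; eexists; exact: uv.
  apply: nearW => n; rewrite (@le_trans _ _ (expeR (- \int[mu]_x (h n x)%:E)))//.
    rewrite lee_expeR leeN2; apply: ge0_le_integral => //.
    + by move=> x _; rewrite lee_fin.
    + exact/measurable_EFinP.
    + by move=> x _; rewrite lee_fin.
  rewrite -(cvg_lim _ (uU n))//; apply: lime_le.
    by apply/cvg_ex; eexists; exact: uU.
  near=> k; apply: (ni_prod (fun x => 1 - h n x)%R) => //.
    exact: measurable_funB.
  near: k; exact: nbhs_infty_ge.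
Unshelve. all: by end_near. Qed.

End laplace.

(** * Void probabilities of marked Poisson processes *)

Section path_space.
Context (I : Type) (dU : measure_display) (U : measurableType dU).

(** Its measurable sets are those of [path_sigma D]; as a measurable type it turns processes into
    measurable maps. *)
Definition path_space (D : set I) := g_sigma_algebraType
  [set A : set (I -> U) | exists2 t, D t &
    exists2 B : set U, measurable B & A = [set f | B (f t)]].

Lemma measurable_coord (D : set I) t : D t ->
  measurable_fun setT (fun f : path_space D => f t).
Proof.
move=> Dt _ B mB; rewrite setTI; apply: sub_sigma_algebra.
by exists t => //; exists B.
Qed.

Lemma measurable_path (D : set I) d (T : measurableType d) (X : T -> I -> U) :
  (forall t, D t -> measurable_fun setT (X ^~ t)) ->
  measurable_fun setT (X : T -> path_space D).
Proof.
move=> mX; apply: measurability => // _ [_ [t Dt [B mB ->]] <-].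
exact: mX.
Qed.

End path_space.
Arguments path_space {I dU} U D.

Section marked_void.
Context (R : realType) (d d0 dE : measure_display).
Context (T : measurableType d) (P : probability T R).
Context (T0 : measurableType d0) (P0 : probability T0 R).
Context (E : measurableType dE) (mu : {measure set E -> \bar R}).
Variables (D : set R) (Z : T -> nat -> E) (Y : nat -> T -> R -> R).
Variable X : T0 -> R -> R.
Hypothesis ppp : poisson_point_process P mu Z.
Hypothesis mX : forall t, D t -> measurable_fun setT (X ^~ t).
Hypothesis mY : forall i t, D t -> measurable_fun setT (Y i ^~ t).
Hypothesis copies : independent_copies D P0 X P Z Y.
Variable A : set (E * path_space (measurableTypeR R) D).
Hypothesis mA : measurable A.

(** Integrating out the marks replaces each indicator by [g (Z w i)], the conditional probability
    that the mark is good. The expected product is then the Laplace functional, and integrating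
    [1 - g] against [mu] gives the product measure of the bad pairs. *)
Lemma marked_void :
  P [set w | forall i, A (Z w i, Y i w)] =
  expeR (- (mu \x P0) [set zx | ~ A (zx.1, X zx.2)])%E.
Proof.
have [lawY indY] := copies.
have mX' : measurable_fun setT (X : T0 -> path_space (measurableTypeR R) D).
  exact: measurable_path.
have mY' i : measurable_fun setT (Y i : T -> path_space (measurableTypeR R) D).
  by apply: measurable_path => t; exact: mY.
have mZ i : measurable_fun setT (Z ^~ i) by case: ppp.
have mZ' : measurable_fun setT (Z : T -> path_space E [set: nat]).
  by apply: measurable_path => i _; exact: mZ.
pose g := mark_prob P0 (X : T0 -> path_space (measurableTypeR R) D) A.
have mg : measurable_fun setT g by exact: measurable_mark_prob.
have g01 x : 0 <= g x <= 1.
  by rewrite mark_prob_ge0 ?mark_prob_le1.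
have mark m : (\int[P]_w (\prod_(i < m) \1_A (Z w i, Y i w))%:E =
   \int[P]_w (\prod_(i < m) g (Z w i))%:E)%E.
  have := @marked_product R _ _ _ _ _ T P T0 P0 _ E _
    (Z : T -> path_space E [set: nat]) (fun i z => z i)
    (fun i => (Y i : T -> path_space (measurableTypeR R) D)) X mZ' _ mY' mX' lawY indY A mA m
    (cst 1) _ _.
  under eq_integral do rewrite /= mul1r.
  under [in RHS]eq_integral do rewrite /= mul1r.
  apply => //.
  by move=> i; exact: measurable_coord.
have := poisson_laplace ppp mg g01.
under eq_fun do rewrite -mark.
move=> lim1.
have -> : ((mu \x P0) [set zx | ~ A (zx.1, X zx.2)] =
    \int[mu]_x (1 - g x)%:E)%E.
  apply: eq_integral => z _.
  have mAz : measurable [set x | A (z, X x)].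
    rewrite -[X in measurable X]setTI.
    exact: (measurable_fun_pair (measurable_cst z) mX' measurableT mA).
  rewrite /g /mark_prob EFinB fineK ?fin_num_measure// -probability_setC//.
  by rewrite /= xsectionE.
rewrite -(cvg_lim _ lim1)//; apply/esym/cvg_lim => //.
pose F m := [set w | forall i, (i < m)%N -> A (Z w i, Y i w)].
have mF1 i : measurable [set w | A (Z w i, Y i w)].
  rewrite -[X in measurable X]setTI.
  exact: (measurable_fun_pair (mZ i) (mY' i) measurableT mA).
have mF m : measurable (F m).
  rewrite (_ : F m = \bigcap_(i < m) [set w | A (Z w i, Y i w)])//.
  exact: bigcap_measurableType.
have -> : [set w | forall i, A (Z w i, Y i w)] = \bigcap_m F m.
  apply/seteqP; split => [w Aw m _ i _|w Fw i]; first exact: Aw.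
  exact: (Fw i.+1).
have intF m : (\int[P]_w (\prod_(i < m) \1_A (Z w i, Y i w))%:E = P (F m))%E.
  transitivity (\int[P]_w (\1_(F m) w)%:E)%E; last first.
    by rewrite integral_indic// setIT.
  apply: eq_integral => w _.
  congr _%:E.
  have [Fw|/existsNP[i /not_implyP[im NA]]] := pselect (F m w).
    by rewrite indicE mem_set// big1// => i _; rewrite indicE mem_set//; exact: Fw.
  rewrite [RHS]indicE memNset; last by move=> /(_ i im).
  by rewrite (bigD1 (Ordinal im))//= indicE memNset// mul0r.
under eq_fun do rewrite intF.
apply: nonincreasing_cvg_mu => //.
- by rewrite (@le_lt_trans _ _ 1%E) ?ltry// probability_le1.
- exact: bigcapT_measurable.
- by move=> m n mn; apply/subsetPset => w Fw i im; apply: Fw; exact: leq_trans mn.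
Qed.

End marked_void.

(** * Exponential intensity and the grid measure *)

Section exponential_intensity.
Local Open Scope ereal_scope.
Context (R : realType).
Notation mu := (@lebesgue_measure R).

Let mexp : measurable_fun [set: R] (fun x => (expR (- x))%:E).
Proof. by apply/measurable_EFinP; exact: measurableT_comp. Qed.

(** [exp_intensity] under a name that carries the structure of a sigma-finite measure, as Tonelli
    requires; [grid_mu] does the same for [grid_measure]. *)
Definition expo : set (measurableTypeR R) -> \bar R := @exp_intensity R.

Let expo0 : expo set0 = 0.
Proof. by rewrite /expo /exp_intensity integral_set0. Qed.

Let expo_ge0 B : 0 <= expo B.
Proof. by apply: integral_ge0 => x _; rewrite lee_fin expR_ge0. Qed.

Let expo_sigma_additive : semi_sigma_additive expo.
Proof.
move=> F mF tF mUF; rewrite /expo /exp_intensity ge0_integral_bigcup//.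
- by apply: is_cvg_nneseries => n _ _; exact: expo_ge0.
- exact: measurable_funS mexp.
Qed.

HB.instance Definition _ := isMeasure.Build _ _ _ expo
  expo0 expo_ge0 expo_sigma_additive.

Lemma expo_ray (c : R) : expo `]c, +oo[%classic = (expR (- c))%:E.
Proof.
rewrite /expo /exp_intensity integral_itv_obnd_cbnd; last first.
  exact: measurable_funS mexp.
have cexpN : continuous (fun x : R => expR (- x)).
  move=> x; apply: continuous_comp; last exact: continuous_expR.
  by apply: (@continuousN _ R^o).
rewrite (@ge0_continuous_FTC2y _ _ (fun x => - expR (- x))%R _ 0%R).
- by rewrite sub0e EFinN oppeK.
- by move=> x _; exact: expR_ge0.
- exact: continuous_subspaceT.
- by rewrite -oppr0; apply: cvgN; exact: cvgr_expR.
- by move=> x _; exact: ex_derive.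
- by apply/cvg_at_right_filter; apply: cvgN; exact: cexpN.
- move=> x _; rewrite derive1_comp// derive1N// derive1_id mulN1r.
  rewrite derive1_comp// derive1E.
  have /funeqP -> := @derive_expR R.
  by rewrite derive1N// derive1_id mulrN1 opprK.
Qed.

Let expo_sigma_finite : sigma_finite setT expo.
Proof.
exists (fun n => `](- n%:R)%R, +oo[%classic).
  apply/esym; rewrite -subTset => x _; exists (Num.truncn `|x|).+1 => //=.
  rewrite in_itv/= andbT ltrNl; apply: (@le_lt_trans _ _ `|x|%R).
    by rewrite -normrN ler_norm.
  by rewrite truncnS_gt.
by move=> n; split => //; rewrite expo_ray ltry.
Qed.

HB.instance Definition _ := Measure_isSigmaFinite.Build _ _ _ expo
  expo_sigma_finite.

(** The set is a union of open rays []- a, +oo[], hence open, so measurable even if [A] is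
    uncountable, and squeezed between these rays and the ray that starts at minus the supremum of
    [A]. *)
Lemma expo_up (A : set R) : A !=set0 ->
  expo [set p | exists2 a, A a & (0 < p + a)%R] =
  ereal_sup [set (expR a)%:E | a in A].
Proof.
move=> A0; set U := [set p | _].
have mU : measurable U.
  rewrite (_ : U = \bigcup_(a in A) `](- a)%R, +oo[%classic).
    apply: open_measurable; apply: bigcup_open => a _.
    exact: interval_open.
  apply/seteqP; split => [p [a Aa pa]|p [a Aa] /=].
    by exists a => //; rewrite /= in_itv/= andbT; lra.
  by rewrite in_itv/= andbT => pa; exists a => //; lra.
apply/eqP; rewrite eq_le; apply/andP; split; last first.
  apply: ub_ereal_sup => _ [a Aa <-].
  rewrite -{1}(opprK a) -expo_ray; apply: le_measure; rewrite ?inE//.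
  by move=> p /=; rewrite in_itv/= andbT => pa; exists a => //; lra.
have := ereal_sup_ubound.
set S := ereal_sup _ => Sub.
have Sge a : A a -> (expR a)%:E <= S by move=> Aa; apply: Sub; exists a.
case: S Sub Sge => [s| |] _ Sge; last 2 first.
- by rewrite leey.
- by case: A0 => a /Sge.
have s0 : (0 < s)%R.
  by case: A0 => a /Sge; rewrite lee_fin; apply: lt_le_trans; exact: expR_gt0.
have lnsK : expR (ln s) = s by rewrite lnK.
have -> : s%:E = expo `](- ln s)%R, +oo[%classic by rewrite expo_ray opprK lnsK.
apply: le_measure; rewrite ?inE// => p [a Aa pa] /=.
rewrite in_itv/= andbT.
have : (a <= ln s)%R by rewrite -ler_expR lnsK; have := Sge a Aa; rewrite lee_fin.
lra.
Qed.

End exponential_intensity.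

Section grid.
Context (R : realType) (delta : {nonneg R}).

Lemma grid_eq0 : delta%:num = 0 -> grid delta = setT.
Proof. by move=> d0; rewrite /grid d0 eqxx. Qed.

Lemma grid_neq0 : delta%:num != 0 ->
  grid delta = range (fun k : int => delta%:num * k%:~R).
Proof. by move=> /negbTE d0; rewrite /grid d0. Qed.

Lemma grid0 : grid delta 0.
Proof. by rewrite /grid; case: ifP => // _; exists 0; rewrite ?mulr0. Qed.

Lemma gridB s t : grid delta s -> grid delta t -> grid delta (s - t).
Proof.
rewrite /grid; case: ifP => // _ [j _ <-] [k _ <-]; exists (j - k) => //.
by rewrite intrB mulrBr.
Qed.

Lemma gridD s t : grid delta s -> grid delta t -> grid delta (s + t).
Proof.
move=> gs gt; rewrite -(opprK t) -(sub0r t); apply: gridB => //.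
exact: gridB grid0 gt.
Qed.

Lemma grid_mulrn s n : grid delta s -> grid delta (s *+ n).
Proof.
by move=> gs; elim: n => [|n IH]; [exact: grid0|rewrite mulrS; exact: gridD].
Qed.

Lemma countable_grid : delta%:num != 0 -> countable (grid delta).
Proof.
move=> d0; rewrite grid_neq0//.
by apply: card_le_trans (card_image_le _ _) _; exact: countableP.
Qed.

Local Open Scope ereal_scope.
Notation nu := (grid_measure delta).

Lemma grid_measureE0 : delta%:num = 0%R -> nu = lebesgue_measure :> (set R -> \bar R).
Proof. by move=> d0; rewrite /grid_measure d0 eqxx. Qed.

Lemma grid_measureE (B : set R) : delta%:num != 0%R ->
  nu B = delta%:num%:E * counting (B `&` grid delta).
Proof. by move=> /negbTE d0; rewrite /grid_measure d0. Qed.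

Lemma grid_measureC : nu (~` grid delta) = 0.
Proof.
have [d0|d0] := eqVneq delta%:num 0%R.
  by rewrite grid_eq0// setCT measure0.
by rewrite grid_measureE// setICl measure0 mule0.
Qed.

Lemma sigma_finite_grid_measure : sigma_finite setT nu.
Proof.
have [d0|d0] := eqVneq delta%:num 0%R.
  by rewrite grid_measureE0//; exact: sigma_finiteT.
have mg := measurable_grid delta.
(* The complement of the grid is null, so it may be added to every piece without spoiling
   finiteness. *)
exists (fun n => ~` grid delta `|` [set delta%:num * n%:R; - (delta%:num * n%:R)]%R).
  apply/esym; rewrite -subTset => x _.
  have [|gx] := pselect (grid delta x); last by exists 0%N => //; left.
  rewrite grid_neq0// => -[[n|n] _ <-].
    by exists n => //; right; left; rewrite pmulrn.
  by exists n.+1 => //; right; right; rewrite NegzE mulrNz mulrN pmulrn.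
move=> n; split.
  by apply: measurableU; [exact: measurableC|exact: measurableU].
rewrite grid_measureE// lte_mul_pinfty//.
rewrite setIUl setICl set0U /counting asboolT ?ltry//.
by apply: finite_setIl; exact: finite_set2.
Qed.

Definition grid_mu : set (measurableTypeR R) -> \bar R := nu.

HB.instance Definition _ := isMeasure.Build _ _ _ grid_mu
  (measure0 nu) (measure_ge0 nu) (@measure_semi_sigma_additive _ _ _ nu).

HB.instance Definition _ := Measure_isSigmaFinite.Build _ _ _ grid_mu
  sigma_finite_grid_measure.

Lemma measurable_fun_grid (f : R -> \bar R) : delta%:num != 0%R ->
  measurable_fun (grid delta : set (measurableTypeR R)) f.
Proof.
move=> d0 _ B _; apply: countable_measurable => //.
by apply: sub_countable (countable_grid d0); apply: subset_card_le => t [].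
Qed.

Lemma integral_grid (f : R -> \bar R) : delta%:num != 0%R ->
  (forall t, 0 <= f t) ->
  \int[nu]_(t in grid delta) f t =
  delta%:num%:E * \esum_(t in grid delta) f t.
Proof.
move=> d0 f0.
have : (grid delta #= [set: nat])%card.
  apply: eq_card_nat; first exact: countable_grid.
  apply/infiniteP/pcard_leP/injfunPex.
  exists (fun n => delta%:num * n%:R)%R => [n _|m n _ _].
    by rewrite grid_neq0//; exists n => //; rewrite pmulrn.
  by move/(mulfI d0)/eqP; rewrite eqr_nat => /eqP.
rewrite card_eq_sym => /card_set_bijP[g gbij].
have [gG ginj gsurj] := gbij.
have gE : grid delta = \bigcup_n [set g n].
  apply/seteqP; split => [t /gsurj[n _ <-]|t [n _ ->]]; first by exists n.
  exact: gG.
have nug n : nu [set g n] = delta%:num%:E.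
  rewrite grid_measureE// setIidl; last by move=> _ ->; exact: gG.
  by rewrite /counting asboolT// fset_set1 cardfs1 mule1.
rewrite (@reindex_esum R _ _ [set: nat] (grid delta) g f gbij).
rewrite {1}gE ge0_integral_bigcup//; last 2 first.
- by rewrite -gE; exact: measurable_fun_grid.
- apply/trivIsetP => m n _ _ mn; apply/seteqP; split => // t [-> /ginj nm].
  by rewrite nm ?inE ?eqxx in mn.
rewrite -nneseries_esumT// -nneseriesZl//; apply: eq_eseriesr => n _.
rewrite (eq_integral (cst (f (g n)))); last by move=> t; rewrite inE => ->.
by rewrite integral_cst// [X in _ * X]nug muleC.
Qed.

Lemma int_expE (f : R -> R) :
  int_exp delta f = \int[nu]_(t in grid delta) (expR (f t))%:E.
Proof.
rewrite /int_exp; have [d0|d0] := eqVneq delta%:num 0%R.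
  by rewrite grid_eq0//; apply: eq_measure_integral => A _ _; rewrite grid_measureE0.
by rewrite integral_grid// => t; rewrite lee_fin expR_ge0.
Qed.

(** One reflection turns the integral of [F (- s)] into that of [F s]; two reflections compose to a
    translation, so shift invariance follows as well. *)
Lemma integral_grid_reflect (a : R) (f : R -> \bar R) : grid delta a ->
  measurable_fun [set: R] f -> (forall t, 0 <= f t) ->
  \int[nu]_(t in grid delta) f (a - t)%R = \int[nu]_(t in grid delta) f t.
Proof.
move=> ga mf f0; have [d0|d0] := eqVneq delta%:num 0%R; last first.
  rewrite !integral_grid//; congr *%E.
  apply/esym/(@reindex_esum R _ _ _ _ (fun t => a - t)%R); split.
  - by move=> t gt; exact: gridB.
  - by move=> s t _ _ /addrI/oppr_inj.
  - by move=> t gt; exists (a - t)%R; [exact: gridB|rewrite subKr].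
rewrite grid_eq0//.
have nuE g : \int[nu]_t g t = \int[lebesgue_measure]_t g t.
  by apply: eq_measure_integral => A _ _; rewrite grid_measureE0.
rewrite !nuE.
have mB : measurable_fun setT ((fun t => a - t)%R : _ -> measurableTypeR R).
  exact: measurable_funB.
have /(_ mB) := @ge0_integral_pushforward _ _ (measurableTypeR R)
  (measurableTypeR R) R (fun t => a - t)%R.
move=> /(_ lebesgue_measure setT f measurableT mf) pushE.
rewrite -[LHS]pushE//.
apply: eq_measure_integral => A mA _.
apply/esym/lebesgue_measure_unique => //= _ [[b c]] _ <-.
rewrite /pushforward.
rewrite (_ : _ @^-1` _ = `[(a - c)%R, (a - b)%R[%classic).
  rewrite !lebesgue_measure_itv/= !lte_fin ltrD2l ltrN2.
  by case: ifP => // _; rewrite -!EFinD; congr _%:E; ring.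
by apply/seteqP; split => t /=; rewrite !in_itv/= => /andP[? ?]; apply/andP; split; lra.
Qed.

(** For [delta > 0] the endpoint [0] counts too: the window holds more than [T / delta] points, each
    of mass [delta]. *)
Lemma grid_measure_itv (T : R) : (0 <= T)%R ->
  T%:E <= nu (grid delta `&` `[0%R, T]).
Proof.
move=> T0; have [d0|d0] := eqVneq delta%:num 0%R.
  rewrite grid_eq0// setTI grid_measureE0// lebesgue_measure_itv/= lte_fin.
  by rewrite sube0; case: ltP.
have dpos : (0 < delta%:num)%R by rewrite lt_neqAle eq_sym d0/=.
pose n := Num.truncn (T / delta%:num).
pose e k := (delta%:num * k%:R)%R.
have sub : e @` `I_n.+1 `<=` grid delta `&` `[0%R, T].
  move=> _ [k /= kn <-]; split; first by rewrite grid_neq0//; exists k => //; rewrite pmulrn.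
  rewrite /= in_itv/= mulr_ge0//= /e mulrC -ler_pdivlMr//.
  rewrite (@le_trans _ _ n%:R)//; first by rewrite ler_nat -ltnS.
  by rewrite truncn_le// divr_ge0// ltW.
rewrite grid_measureE// setIAC setIid.
have : (@counting _ R (e @` `I_n.+1)) = n.+1%:R%:E.
  rewrite /counting asboolT; last exact/finite_image/finite_II.
  rewrite (@card_fset_set _ _ n.+1)//; apply: inj_card_eq.
  by move=> i j _ _ /(mulfI d0)/eqP; rewrite eqr_nat => /eqP.
move=> cE.
apply: (@le_trans _ _ (delta%:num%:E * n.+1%:R%:E)).
  rewrite -EFinM lee_fin -ler_pdivrMl// mulrC ltW//.
  exact: truncnS_gt.
rewrite lee_pmul2l// -cE; apply: (@le_measure _ _ _ counting) => //.
- rewrite inE; apply: countable_measurable; first by move=> x; exact: measurable_set1.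
  by apply: card_le_trans (card_image_le _ _) _; exact: countableP.
- by rewrite inE; apply: measurableI => //; exact: measurable_grid.
Qed.

End grid.

(** * Evaluation and separability of regular paths *)

Section evaluation.
Context (R : realType) (delta : {nonneg R}).

(* Only the restriction to [grid delta] is constrained when [0 < delta]. *)
Definition regular_path (f : R -> R) := delta%:num = 0 -> cadlag f.

Lemma measurable_eval_countable (d : measure_display) (T : measurableType d)
    (X : T -> R -> R) (c : int -> R) (g : T -> R) :
  (forall k, measurable_fun setT (fun w => X w (c k))) ->
  measurable_fun setT g -> (forall w, exists k, g w = c k) ->
  measurable_fun setT (fun w => X w (g w)).
Proof.
move=> mX mg gc _ B mB; rewrite setTI.
have -> : (fun w => X w (g w)) @^-1` B = \bigcup_k
    ((g @^-1` [set c k]) `&` (fun w => X w (c k)) @^-1` B).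
  apply/seteqP; split => [w /= Bw|w [k _ [/= -> //]]].
  by have [k gk] := gc w; exists k => //; split => //=; rewrite -gk.
apply: countable_bigcupT_measurable; first exact: countableP.
move=> k; apply: measurableI; rewrite -[X in measurable X]setTI.
  by apply: mg => //; exact: measurable_set1.
exact: mX.
Qed.

(** The [+ 1] places the point strictly to the right of [u], within [1 / n.+1], so that right limits
    apply. For [delta > 0] the default [0] ensures that only coordinates in the grid are read. *)
Definition grid_point (n : nat) (u : R) : R :=
  if delta%:num == 0 then (Num.floor (n.+1%:R * u) + 1)%:~R / n.+1%:R
  else if u \in grid delta then u else 0.

Lemma measurable_grid_point n : measurable_fun setT (grid_point n).
Proof.
rewrite /grid_point; have [d0|d0] := eqVneq delta%:num 0.
  apply: nondecreasing_measurable => // s t st.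
  by rewrite ler_pM2r// ler_int lerD2r le_floor// ler_pM2l.
apply: measurable_fun_ifT => //; apply: (measurable_fun_bool true).
rewrite setTI (_ : _ @^-1` _ = grid delta); first exact: measurable_grid.
by apply/seteqP; split => t /= => [/set_mem|/mem_set].
Qed.

(** A jointly measurable substitute for [f u]. A limit superior exists for every path, and for each
    [n] only countably many coordinates are involved. *)
Definition eval (u : R) (f : R -> R) : R :=
  fine (limn_esup (fun n => (f (grid_point n u))%:E)).

Lemma measurable_eval : measurable_fun setT
  (fun uf : R * path_space (measurableTypeR R) (grid delta) => eval uf.1 uf.2).
Proof.
rewrite /eval; apply: measurableT_comp => //.
apply: measurable_fun_limn_esup => n; apply/measurable_EFinP.
pose c (k : int) : R := if delta%:num == 0 then (k + 1)%:~R / n.+1%:R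
  else delta%:num * k%:~R.
apply: (@measurable_eval_countable _ _
  (fun uf : R * path_space (measurableTypeR R) (grid delta) => uf.2) c).
- move=> k; have gk : grid delta (c k).
    rewrite /c /grid; have [//|d0] := eqVneq delta%:num 0.
    by exists k.
  have mc := @measurable_coord _ _ (measurableTypeR R) _ _ gk.
  exact: (measurableT_comp mc).
- by apply: measurableT_comp => //; exact: measurable_grid_point.
- move=> [u f]; rewrite /grid_point /c; have [d0|d0] := eqVneq delta%:num 0.
    by exists (Num.floor (n.+1%:R * u)).
  case: ifPn => [|_]; last by exists 0; rewrite mulr0.
  by rewrite inE grid_neq0// => -[k _ <-]; exists k.
Qed.

Lemma evalE u f : grid delta u -> regular_path f -> eval u f = f u.
Proof.
move=> gu rf; rewrite /eval; suff cf :
    (f (grid_point n u))%:E @[n --> \oo] --> (f u)%:E.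
  have lf := cvgP _ cf.
  by rewrite is_cvg_limn_esupE// (cvg_lim _ cf).
apply: cvg_EFin; first exact: nearW.
have [d0|d0] := eqVneq delta%:num 0; last first.
  rewrite /grid_point (negbTE d0) mem_set//; exact: cvg_cst.
have [rcf _] := rf d0.
move: (rcf u) => /cvgrPdist_lt fu; apply/cvgrPdist_lt => e e0.
have [e' /= e'0 fe] := fu e e0.
have small : \forall n \near \oo, n.+1%:R^-1 < e' :> R.
  exact: (near_infty_natSinv_lt (PosNum e'0)).
near=> n.
have N0 : 0 < n.+1%:R :> R by [].
have [ugp gpu] : u < grid_point n u /\ grid_point n u <= u + n.+1%:R^-1.
  rewrite /grid_point d0 eqxx; split.
    by rewrite ltr_pdivlMr// mulrC floorD1_gt.
  rewrite ler_pdivrMr// mulrDl mulVf ?gt_eqF// intrD lerD2r mulrC.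
  exact: floor_le.
have sn : n.+1%:R^-1 < e' by near: n.
apply: fe => //=; rewrite ltr0_norm ?subr_lt0// opprB ltrBlDl.
by rewrite (le_lt_trans gpu)// ltrD2l.
Unshelve. all: by end_near. Qed.

End evaluation.

Lemma countable_seq (R : realType) (D : set R) (a : R) : countable D -> D a ->
  exists e : nat -> R, (forall n, D (e n)) /\ forall t, D t -> exists n, e n = t.
Proof.
move=> /countable_injP[f finj] Da.
pose e n := if pselect (exists2 t, D t & f t = n) is left h then sval (cid2 h) else a.
exists e; split => [n|t Dt]; rewrite /e.
  by case: pselect => // h; case: (cid2 h).
exists (f t); case: pselect => [h|[]]; last by exists t.
by case: (cid2 h) => s Ds /= fs; apply: finj; rewrite ?inE.
Qed.

(** If [f t > x], right-continuity gives a rational time just after [t], still in [I], where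
    [f > x]. A right endpoint [b] has no such neighbour in [I] and is therefore enumerated
    explicitly; [a] keeps the set of times non-empty. For [delta > 0] all grid points of [I] are
    enumerated. *)
Lemma grid_separant (R : realType) (delta : {nonneg R}) (I : set R) (a b : R) :
  grid delta a -> I a ->
  (forall t, I t -> t = b \/ exists2 e, 0 < e & `]t, t + e[ `<=` I) ->
  exists e : nat -> R, (forall n, grid delta (e n) /\ I (e n)) /\
    forall f, regular_path delta f -> forall x, (forall n, f (e n) <= x) ->
    forall t, grid delta t -> I t -> f t <= x.
Proof.
move=> ga Ia Ir; have [d0|d0] := eqVneq delta%:num 0; last first.
  have [|e [eD De]] := @countable_seq R (grid delta `&` I) a _ (conj ga Ia).
    by apply: sub_countable (countable_grid d0); apply: subset_card_le => t [].
  exists e; split => // f _ x fx t gt It.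
  by have [n <-] := De t (conj gt It).
pose D := I `&` ([set a; b] `|` range (@ratr R)).
have Da : D a by split => //; left; left.
have [|e [eD De]] := @countable_seq R D a _ Da.
  pose g (o : bool + rat) : R :=
    match o with inl true => a | inl false => b | inr q => ratr q end.
  apply: (@sub_countable _ _ _ (range g)).
    apply: subset_card_le => t [_ [[->|->]|[q _ <-]]].
    + by exists (inl true).
    + by exists (inl false).
    + by exists (inr q).
  by apply: card_le_trans (card_image_le _ _) _; exact: countableP.
exists e; split => [n|f rf x fx t _ It].
  by rewrite grid_eq0//; split => //; case: (eD n).
rewrite leNgt; apply/negP => xft.
have [tb|[r r0 rI]] := Ir t It.
  have [n et] : exists n, e n = t by apply: De; split => //; left; right.
  by have := fx n; rewrite et leNgt xft.
have [rcf _] := rf d0.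
move: (rcf t) => /cvgrPdist_lt /(_ (f t - x)).
rewrite subr_gt0 => /(_ xft)[e' /= e'0 fe].
have [q] : exists q : rat, ratr q \in `]t, t + Num.min r e'[.
  by apply: rat_in_itvoo; rewrite ltrDl lt_min r0.
rewrite in_itv/= => /andP[tq qr].
have [n eq] : exists n, e n = ratr q.
  apply: De; split; last by right; exists q.
  by apply: rI; rewrite /= in_itv/= tq (lt_le_trans qr)// lerD2l ge_min lexx.
have := fx n; rewrite eq leNgt => /negP; apply.
have /= := fe (ratr q).
rewrite ltr0_norm ?subr_lt0// opprB ltrBlDl.
have qe : ratr q < t + e' by rewrite (lt_le_trans qr)// lerD2l ge_min lexx orbT.
move=> /(_ qe tq) /(le_lt_trans (ler_norm _)); lra.
Qed.

(** * Exponent measures of the two constructions *)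

Definition image_measure (R : realType) (d d' : measure_display)
    (T : measurableType d) (U : measurableType d')
    (m : {measure set T -> \bar R}) (f : T -> U)
    (mf : measurable_fun setT f) : {measure set U -> \bar R} :=
  measure_function_pushforward__canonical__measure_function_Measure m mf.

Section cylinders.
Context (R : realType) (D : set R).
Notation K := (path_space (measurableTypeR R) D).

Definition below (s : seq (R * R)) : set (R -> R) :=
  [set f | forall tx, tx \in s -> f tx.1 <= tx.2].

Definition times_in (s : seq (R * R)) := forall tx, tx \in s -> D tx.1.

Lemma below_nil : below [::] = setT.
Proof. by rewrite -subTset => f _ tx. Qed.

Lemma below_cons tx s : below (tx :: s) = [set f | f tx.1 <= tx.2] `&` below s.
Proof.
apply/seteqP; split => [f fs|f [ftx fs] ty].
  by split => [|ty tys]; apply: fs; rewrite inE ?eqxx ?tys ?orbT.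
by rewrite inE => /orP[/eqP ->//|]; exact: fs.
Qed.

Lemma below_cat s1 s2 : below (s1 ++ s2) = below s1 `&` below s2.
Proof.
elim: s1 => [|tx s1 IH]; first by rewrite below_nil setTI.
by rewrite cat_cons !below_cons IH setIA.
Qed.

Lemma times_in_cons tx s : times_in (tx :: s) -> D tx.1 /\ times_in s.
Proof.
move=> h; split => [|ty tys]; first by apply: h; rewrite inE eqxx.
by apply: h; rewrite inE tys orbT.
Qed.

Lemma measurable_le_coord t x : D t -> measurable [set f : K | f t <= x].
Proof.
move=> Dt; rewrite -[X in measurable X]setTI.
have := @measurable_coord _ _ (measurableTypeR R) D t Dt measurableT _
  (measurable_itv `]-oo, x]).
by congr (measurable (_ `&` _)); apply/seteqP; split => f /=; rewrite in_itv.
Qed.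

Lemma measurable_gt_coord t x : D t -> measurable [set f : K | x < f t].
Proof.
move=> Dt; rewrite (_ : [set _ | _] = ~` [set f : K | f t <= x]).
  by apply: measurableC; exact: measurable_le_coord.
by apply/seteqP; split => f /=; rewrite ltNge => /negP.
Qed.

Lemma measurable_below s : times_in s -> measurable (below s : set K).
Proof.
elim: s => [|tx s IH]; first by rewrite below_nil.
move=> /times_in_cons[Dt Ds]; rewrite below_cons.
by apply: measurableI; [exact: measurable_le_coord|exact: IH].
Qed.

Lemma path_space_generated : @measurable _ K `<=`
  <<s [set below s | s in times_in] >>.
Proof.
set G := [set below s | s in times_in].
apply: smallest_sub; first exact: smallest_sigma_algebra.
move=> _ [t Dt [B mB ->]].
have mt : measurable_fun setT (fun f : g_sigma_algebraType G => f t).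
  apply: (measurability _ (RGenOInfty.measurableE R)).
  move=> _ [_ [x ->] <-]; rewrite setTI.
  rewrite (_ : _ @^-1` _ = ~` below [:: (t, x)]).
    apply: measurableC; apply: sub_sigma_algebra; exists [:: (t, x)] => //.
    by move=> ty; rewrite inE => /eqP ->.
  rewrite below_cons below_nil setIT.
  by apply/seteqP; split => f /=; rewrite in_itv/= andbT ltNge => /negP.
by have := mt measurableT B mB; rewrite setTI.
Qed.

Local Open Scope ereal_scope.

(* On [{f | 0 < f 0}] both measures are finite, and there they are determined by
   inclusion-exclusion from their values on complements of the sets [below s]. *)
Lemma exponent_measure_unique (mu1 mu2 : {measure set K -> \bar R}) : D 0%R ->
  (forall t x, D t -> mu1 [set f : K | x < f t]%R < +oo) ->
  (forall s, times_in s -> mu1 (~` below s) = mu2 (~` below s)) ->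
  forall A : set K, measurable A ->
  mu1 (A `&` [set f : K | 0 < f 0]%R) = mu2 (A `&` [set f : K | 0 < f 0]%R).
Proof.
move=> D0 fin1 eq12 A mA; set B0 := [set f : K | _].
have mB0 : measurable (B0 : set K) by exact: measurable_gt_coord.
have finb s : times_in s -> mu1 (~` below s) < +oo.
  elim: s => [|tx s IH]; first by rewrite below_nil setCT measure0.
  move=> /times_in_cons[Dt Ds]; rewrite below_cons setCI.
  have m1 : measurable (~` [set f : K | f tx.1 <= tx.2]%R).
    by apply: measurableC; exact: measurable_le_coord.
  have m2 : measurable (~` below s : set K) by apply: measurableC; exact: measurable_below.
  rewrite (le_lt_trans (measureU2 _ m1 m2))// lte_add_pinfty ?IH//.
  rewrite (_ : ~` _ = [set f : K | tx.2 < f tx.1]%R) ?fin1//.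
  by apply/seteqP; split => f /=; rewrite ltNge => /negP.
(* Adding the constraint [f 0 <= 0] to [s] enlarges the complement by exactly [below s & B0], whose
   measure is thus a difference of two known numbers, finite by [finb]. *)
have cylE (mu : {measure set K -> \bar R}) s : times_in s ->
    mu (~` below ((0, 0)%R :: s)) = mu (~` below s) + mu (below s `&` B0).
  move=> Ds; rewrite -measureU.
  - congr (mu _); rewrite below_cons setCI.
    apply/seteqP; split => f.
      have [fs|fs] := pselect (below s f); last by left.
      by case=> [/negP|//]; rewrite -ltNge => f0; right.
    by case=> [|[_ f0]]; [right|left; apply/negP; rewrite -ltNge].
  - by apply: measurableC; exact: measurable_below.
  - by apply: measurableI => //; exact: measurable_below.
  - by apply/seteqP; split => // f [] /= nf [].
have T0 s : times_in s -> times_in ((0, 0)%R :: s).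
  by move=> Ds ty; rewrite inE => /orP[/eqP ->//|]; exact: Ds.
pose G : set (set K) := [set below s | s in times_in].
have := @g_sigma_algebra_measure_unique _ R K G _ (fun=> setT) _ _
  (mrestr mu1 mB0) (mrestr mu2 mB0).
apply => //.
- by move=> _ [s Ds <-]; exact: measurable_below.
- by move=> i; exists [::] => //; exact: below_nil.
- by rewrite bigcup_const.
- move=> _ _ [s Ds <-] [s' Ds' <-]; exists (s ++ s'); last exact: below_cat.
  by move=> ty; rewrite mem_cat => /orP[/Ds|/Ds'].
- move=> _ [s Ds <-]; have := eq12 _ (T0 s Ds).
  rewrite (cylE mu1)// (cylE mu2)// eq12//.
  have : mu2 (~` below s) \is a fin_num.
    by rewrite -eq12// ge0_fin_numE// finb.
  move=> f2 e12.
  rewrite -[LHS](addeK _ f2) -[RHS](addeK _ f2); congr (_ - _).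
  by rewrite addeC e12 addeC.
- by move=> k; change (mu1 (setT `&` B0) < +oo); rewrite setTI; exact: fin1.
- exact: path_space_generated.
Qed.

End cylinders.

Section scaled_sigma_finite.
Local Open Scope ereal_scope.
Context (R : realType) (d : measure_display) (T : measurableType d)
  (r : {nonneg R}) (mu : {sigma_finite_measure set T -> \bar R}).

(* [mscale] itself is already keyed, as a sigma-finite measure, to finite [mu]. *)
Definition rescale : set T -> \bar R := mscale r mu.

HB.instance Definition _ := isMeasure.Build _ _ _ rescale
  (measure0 (mscale r mu)) (measure_ge0 (mscale r mu))
  (@measure_semi_sigma_additive _ _ _ (mscale r mu)).

Let rescale_sigma_finite : sigma_finite setT rescale.
Proof.
have [F FT Ffin] := sigma_finiteT mu; exists F => // n.
have [mF Foo] := Ffin n; split => //.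
by rewrite /rescale /mscale lte_mul_pinfty.
Qed.

HB.instance Definition _ := Measure_isSigmaFinite.Build _ _ _ rescale
  rescale_sigma_finite.

Lemma ge0_integral_rescale (f : T -> \bar R) : measurable_fun setT f ->
  (forall x, 0 <= f x) -> \int[rescale]_x f x = r%:num%:E * \int[mu]_x f x.
Proof.
by move=> mf f0; rewrite -ge0_integral_mscale//; exact: eq_measure_integral.
Qed.

End scaled_sigma_finite.

Lemma product_measure_ysection (R : realType) (d1 d2 : measure_display)
    (T1 : measurableType d1) (T2 : measurableType d2)
    (m1 : {sigma_finite_measure set T1 -> \bar R})
    (m2 : {sigma_finite_measure set T2 -> \bar R}) (A : set (T1 * T2)) :
  measurable A -> ((m1 \x m2) A = \int[m2]_y m1 (ysection A y))%E.
Proof.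
move=> mA; transitivity ((m1 \x^ m2) A)%E => //.
apply: product_measure_unique => // B C mB mC.
exact: product_measure2E.
Qed.

Section sigma_finite_product.
Local Open Scope ereal_scope.
Context (R : realType) (d1 d2 : measure_display) (T1 : measurableType d1)
  (T2 : measurableType d2) (m1 : {sigma_finite_measure set T1 -> \bar R})
  (m2 : {sigma_finite_measure set T2 -> \bar R}).

(* [m1 \x m2] itself is keyed, as a sigma-finite measure, to subprobabilities. *)
Definition product_sf : set (T1 * T2) -> \bar R := m1 \x m2.

HB.instance Definition _ := isMeasure.Build _ _ _ product_sf
  (measure0 (m1 \x m2)) (measure_ge0 (m1 \x m2))
  (@measure_semi_sigma_additive _ _ _ (m1 \x m2)).

Let product_sf_sigma_finite : sigma_finite setT product_sf.
Proof.
have /sigma_finiteP[F [FT ndF Foo]] := sigma_finiteT m1.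
have /sigma_finiteP[G [GT ndG Goo]] := sigma_finiteT m2.
exists (fun n => F n `*` G n) => [|n].
  apply/esym; rewrite -subTset => -[x y] _.
  have [i _ Fx] : (\bigcup_i F i) x by rewrite -FT.
  have [j _ Gy] : (\bigcup_i G i) y by rewrite -GT.
  exists (i + j)%N => //; split => /=.
    exact: (subsetPset _ _ (ndF _ _ (leq_addr j i))).
  exact: (subsetPset _ _ (ndG _ _ (leq_addl i j))).
have [[mF Fn] [mG Gn]] := (Foo n, Goo n); split; first exact: measurableX.
by rewrite /product_sf product_measure1E// lte_mul_pinfty// ge0_fin_numE.
Qed.

HB.instance Definition _ := Measure_isSigmaFinite.Build _ _ _ product_sf
  product_sf_sigma_finite.

End sigma_finite_product.

Lemma path_sigma_below (R : realType) (D : set R) (s : seq (R * R)) :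
  times_in D s ->
  path_sigma D [set f : R -> \bar R | forall tx, tx \in s -> (f tx.1 <= tx.2%:E)%E].
Proof.
elim: s => [_|tx s IH].
  have -> : [set f : R -> \bar R |
      forall tx, tx \in [::] -> (f tx.1 <= tx.2%:E)%E] = setT.
    by rewrite -subTset => f _ tx.
  exact: (@measurableT _ (path_space (\bar R) D)).
move=> /times_in_cons[Dt Ds].
have -> : [set f : R -> \bar R |
      forall ty, ty \in tx :: s -> (f ty.1 <= ty.2%:E)%E] =
    [set f | f tx.1 <= tx.2%:E]%E `&`
    [set f | forall ty, ty \in s -> (f ty.1 <= ty.2%:E)%E]; last first.
  apply: (@measurableI _ (path_space (\bar R) D)); last exact: IH.
  rewrite -[X in measurable X]setTI.
  by apply: emeasurable_fun_infty_c => //; exact: measurable_coord.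
apply/seteqP; split => [f fs|f [ftx fs] ty].
  by split => [|ty tys]; apply: fs; rewrite inE ?eqxx ?tys ?orbT.
by rewrite inE => /orP[/eqP ->//|]; exact: fs.
Qed.

Section max_stable_void.
Context (R : realType) (d d' : measure_display).
Context (T : measurableType d) (P : probability T R) (W : T -> R -> R).
Context (T' : measurableType d') (P' : probability T' R).
Variables (p : T' -> nat -> R) (Y : nat -> T' -> R -> R).
Hypothesis cW : cadlag_process W.
Hypothesis construction : max_stable_construction P W P' p Y.

Definition shifted_path (z : measurableTypeR R * T) : R -> R :=
  fun t => z.1 + W z.2 t.

Lemma measurable_shifted_path D :
  measurable_fun setT (shifted_path : _ -> path_space (measurableTypeR R) D).
Proof.
apply: measurable_path => t _; apply: measurable_funD => //.
by apply: (measurableT_comp (cW.1 t)).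
Qed.

(** A supremum lies below a level exactly when every term does, so each finite-dimensional
    distribution function is a void probability. *)
Lemma max_stable_void (s : seq (R * R)) :
  P' [set w | forall tx, tx \in s -> (max_stable p Y w tx.1 <= tx.2%:E)%E] =
  expeR (- (@expo R \x P) [set z | ~ below s (shifted_path z)])%E.
Proof.
have [ppp cY copies] := construction.
pose K := path_space (measurableTypeR R) [set: R].
pose A : set (measurableTypeR R * K) := [set pf | below s (fun t => pf.1 + pf.2 t)].
have mA : measurable A.
  rewrite -[X in measurable X]setTI.
  have mshift : measurable_fun setT
      ((fun pf t => pf.1 + pf.2 t) : measurableTypeR R * K -> K).
    apply: measurable_path => t _; apply: measurable_funD => //.
    have mt := @measurable_coord _ _ (measurableTypeR R) setT t Logic.I.
    exact: (measurableT_comp mt).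
  by apply: mshift => //; apply: measurable_below.
have := @marked_void R _ _ _ T' P' T P (measurableTypeR R) (@expo R) setT
  p Y W ppp _ _ copies A mA.
rewrite /A/= => <-.
- congr (P' _); apply/seteqP; split => [w ws i tx txs|w ws tx txs].
    have := ws tx txs; rewrite /max_stable -lee_fin; apply: le_trans.
    by apply: ereal_sup_ubound; exists i.
  apply: ub_ereal_sup => _ [i _ <-]; rewrite lee_fin.
  exact: ws.
- by move=> t _; exact: cW.1.
- by move=> i t _; exact: (cY i).1.
Qed.

(** For fixed [w], the levels that lift the path above 0 somewhere on [J] form the set of [expo_up];
    the rest is Tonelli. *)
Lemma shifted_path_up (J : set R) : J !=set0 ->
  measurable [set z | exists2 t, J t & 0 < shifted_path z t] ->
  ((@expo R \x P) [set z | exists2 t, J t & (0 < shifted_path z t)%R] =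
   \int[P]_w ereal_sup [set (expR (W w t))%:E | t in J])%E.
Proof.
move=> J0 mS; rewrite product_measure_ysection//.
apply: eq_integral => w _.
have -> : [set (expR (W w t))%:E | t in J] =
    [set (expR a)%:E | a in W w @` J].
  by rewrite image_comp.
rewrite -expo_up; last by case: J0 => t Jt; exists (W w t), t.
congr expo; rewrite ysectionE; apply/seteqP; split => q /=.
  by move=> [t Jt qt]; exists (W w t) => //; exists t.
by move=> [_ [t Jt <-] qt]; exists t.
Qed.

(** The normalization of [exp (W t)] makes this mass finite, which is what [exponent_measure_unique]
    asks for. *)
Lemma shifted_path_gt t x : ('E_P[fun w => expR (W w t)] = 1)%E ->
  ((@expo R \x P) [set z | (x < shifted_path z t)%R] = (expR (- x))%:E)%E.
Proof.
move=> EW.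
have mS : measurable [set z | x < shifted_path z t].
  rewrite -[X in measurable X]setTI.
  have mg := @measurable_gt_coord R setT t x Logic.I.
  exact: (@measurable_shifted_path setT measurableT _ mg).
rewrite product_measure_ysection//.
transitivity (\int[P]_w ((expR (- x))%:E * (expR (W w t))%:E))%E.
  apply: eq_integral => w _; rewrite -EFinM -expRD -[(- x + _)%R]opprK -expo_ray.
  congr expo; rewrite ysectionE; apply/seteqP; split => q;
    by rewrite /= in_itv/= andbT /shifted_path/=; lra.
rewrite ge0_integralZl_EFin ?expR_ge0//.
- by move: EW; rewrite unlock => ->; rewrite mule1.
- apply/measurable_EFinP; apply: measurableT_comp => //; exact: cW.1.
Qed.

End max_stable_void.

Section upcrossings.
Context (R : realType) (D : set R).
Notation K := (path_space (measurableTypeR R) D).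

Definition above (e : nat -> R) : set (R -> R) := [set f | exists n, 0 < f (e n)].

Let zeros (e : nat -> R) n := [seq (e i, 0 : R) | i <- iota 0 n].

Let aboveE e : above e = \bigcup_n ~` below (zeros e n).
Proof.
apply/seteqP; split => [f [n fn]|f [n _ /existsNP[tx /not_implyP[]]]].
  exists n.+1 => // fb; have /fb/= : (e n, 0) \in zeros e n.+1.
    by apply/mapP; exists n => //; rewrite mem_iota/= ltnS.
  by rewrite leNgt fn.
by move=> /mapP[i _ ->] /= /negP; rewrite -ltNge; exists i.
Qed.

Let times_in_zeros e n : (forall i, D (e i)) -> times_in D (zeros e n).
Proof. by move=> De tx /mapP[i _ ->]; exact: De. Qed.

Lemma measurable_above e : (forall n, D (e n)) -> measurable (above e : set K).
Proof.
move=> De; rewrite aboveE; apply: bigcupT_measurable => n.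
by apply: measurableC; apply: measurable_below; exact: times_in_zeros.
Qed.

(** The event is an increasing union of complements of sets [below], so continuity from below
    carries the agreement from finitely to countably many times, infinite masses included. *)
Lemma eq_measure_above (mu1 mu2 : {measure set K -> \bar R}) e :
  (forall n, D (e n)) ->
  (forall s, times_in D s -> mu1 (~` below s) = mu2 (~` below s)) ->
  mu1 (above e) = mu2 (above e).
Proof.
move=> De eq12.
have mz n : measurable (~` below (zeros e n) : set K).
  by apply: measurableC; apply: measurable_below; exact: times_in_zeros.
have mU : measurable (\bigcup_n ~` below (zeros e n) : set K).
  exact: bigcupT_measurable.
have nd : nondecreasing_seq (fun n => ~` below (zeros e n) : set K).
  move=> n m nm; apply/subsetPset => f fn fm; apply: fn => tx /mapP[i].
  rewrite mem_iota => /andP[_ im] ->; apply: fm; apply/mapP; exists i => //.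
  by rewrite mem_iota/=; exact: leq_trans im _.
rewrite aboveE.
rewrite -(cvg_lim _ (nondecreasing_cvg_mu (mu := mu1) mz mU nd))//.
rewrite -(cvg_lim _ (nondecreasing_cvg_mu (mu := mu2) mz mU nd))//.
by congr (limn _); apply/funext => n /=; apply: eq12; exact: times_in_zeros.
Qed.

End upcrossings.

Section m3_void.
Context (R : realType) (delta : {nonneg R}) (C : R) (C0 : 0 < C).
Context (d0 d1 : measure_display) (T0 : measurableType d0) (P0 : probability T0 R)
  (T1 : measurableType d1) (P1 : probability T1 R).
Variables (F : T0 -> R -> R) (Z : T1 -> nat -> R * R) (G : nat -> T1 -> R -> R).
Hypothesis shapeF : shape_process delta F.
Hypothesis ppp : poisson_point_process P1 (@m3_intensity R delta C) Z.
Hypothesis gridZ : forall w i, grid delta (Z w i).1.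
Hypothesis shapeG : forall i, shape_process delta (G i).
Hypothesis copies : independent_copies (grid delta) P0 F P1 Z G.
Notation K := (path_space (measurableTypeR R) (grid delta)).

Lemma shape_process_regular d (T : measurableType d) (X : T -> R -> R) w :
  shape_process delta X -> regular_path delta (X w).
Proof. by move=> [_ X0] d00; exact: (X0 d00).2. Qed.

Definition m3_measure :
    {sigma_finite_measure set (measurableTypeR R * measurableTypeR R)%type -> \bar R} :=
  product_sf (rescale (NngNum (ltW C0)) (grid_mu delta)) (@expo R).

Lemma m3_measureE B : measurable B -> m3_intensity delta C B = m3_measure B.
Proof.
move=> mB; rewrite /m3_measure /= /product_sf /product_measure1.
have mf := measurable_fun_xsection (@expo R) mB.
rewrite ge0_integral_rescale//= -ge0_integralZl//; last by rewrite lee_fin ltW.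
rewrite (@ge0_negligible_integral _ _ _ (grid_mu delta) setT (~` grid delta))//.
- by rewrite setTD setCK /m3_intensity.
- by apply: measurableC; exact: measurable_grid.
- exact: measurable_funeM.
- by move=> x _; rewrite mule_ge0// lee_fin ltW.
- exact: grid_measureC.
Qed.

Let ppp' : poisson_point_process P1 m3_measure Z.
Proof.
case: ppp => mZ fin inf ind; split => //.
  by move=> B r mB Br; apply: fin => //; rewrite m3_measureE.
by move=> B mB By; apply: inf => //; rewrite m3_measureE.
Qed.

(** The use of [eval] makes this measurable jointly in the shift, the height and the shape; for [s]
    and [t] in the grid the value is [F w (t - s) + q]. *)
Definition moved_path (z : (measurableTypeR R * measurableTypeR R) * T0) : R -> R :=
  fun t => eval delta (t - z.1.1) (F z.2) + z.1.2.

Lemma measurable_moved_path : measurable_fun setT (moved_path : _ -> K).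
Proof.
apply: measurable_path => t gt; apply: measurable_funD; last first.
  exact: measurableT_comp.
have mF : measurable_fun setT (F : T0 -> K).
  by apply: measurable_path; exact: shapeF.1.
have mg : measurable_fun setT
    (fun z : (measurableTypeR R * measurableTypeR R) * T0 =>
      (t - z.1.1, (F z.2 : K))).
  apply: measurable_fun_pair; last exact: (measurableT_comp mF).
  apply: measurable_funB => //.
  exact: measurableT_comp.
exact: (measurableT_comp (@measurable_eval R delta) mg).
Qed.

Lemma m3_void (s : seq (R * R)) : times_in (grid delta) s ->
  P1 [set w | forall tx, tx \in s -> (m3_process Z G w tx.1 <= tx.2%:E)%E] =
  expeR (- (m3_measure \x P0) [set z | ~ below s (moved_path z)])%E.
Proof.
move=> Ds.
pose A : set ((measurableTypeR R * measurableTypeR R) * K) :=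
  [set zf | below s (fun t => eval delta (t - zf.1.1) zf.2 + zf.1.2)].
have mA : measurable A.
  have mmove : measurable_fun setT ((fun zf t =>
      eval delta (t - zf.1.1) zf.2 + zf.1.2) :
      (measurableTypeR R * measurableTypeR R) * K -> K).
    apply: measurable_path => t _; apply: measurable_funD; last first.
      exact: measurableT_comp.
    have mg : measurable_fun setT
        (fun z : (measurableTypeR R * measurableTypeR R) * K =>
          (t - z.1.1, z.2)).
      apply: measurable_fun_pair => //; apply: measurable_funB => //.
      exact: measurableT_comp.
    exact: (measurableT_comp (@measurable_eval R delta) mg).
  rewrite -[X in measurable X]setTI.
  exact: (mmove measurableT _ (measurable_below Ds)).
have := @marked_void R _ _ _ T1 P1 T0 P0 _ m3_measure (grid delta)
  Z G F ppp' _ _ copies A mA.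
rewrite /A/= => <-.
- congr (P1 _).
  (* The points sit on the grid, so [t] minus a point does too, and the measurable [eval] may stand
     for the mark itself. *)
  have evG i w t : grid delta t ->
      eval delta (t - (Z w i).1) (G i w) = G i w (t - (Z w i).1).
    by move=> gt; rewrite evalE//; [exact: gridB|exact: shape_process_regular].
  apply/seteqP; split => [w ws i tx txs|w ws tx txs].
    rewrite evG; last exact: Ds.
    have := ws tx txs; rewrite /m3_process -lee_fin; apply: le_trans.
    by apply: ereal_sup_ubound; exists i.
  apply: ub_ereal_sup => _ [i _ <-]; rewrite lee_fin -evG; last exact: Ds.
  exact: (ws i tx txs).
- exact: shapeF.1.
- by move=> i t; exact: (shapeG i).1.
Qed.

End m3_void.

(** * The identity for the M3 constant *)

Lemma ge0_measurable_inve (R : realType) (d : measure_display)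
    (T : measurableType d) (f : T -> \bar R) :
  (forall x, (0 <= f x)%E) -> measurable_fun setT f ->
  measurable_fun setT (fun x => (f x)^-1%E).
Proof.
(* The inverse is composed of measurable pieces: [0] and [+oo] are exchanged, and a positive real
   [y] has inverse [exp (- ln y)]. *)
move=> f0 mf; pose g (y : \bar R) : \bar R :=
  if y == 0%E then +oo%E else if y == +oo%E then 0%E else (expR (- ln (fine y)))%:E.
have -> : (fun x => (f x)^-1%E) = g \o f.
  apply/funext => x; rewrite /g/=; have := f0 x.
  case: (f x) => [r|_|]; [|by rewrite invey eqxx|by rewrite leeNy_eq].
  rewrite lee_fin eqe inver => r0; case: eqVneq => // rN0.
  by rewrite expRN/= lnK// posrE lt_neqAle eq_sym rN0.
apply: measurableT_comp => //; apply: measurable_fun_ifT => //.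
  apply: (measurable_fun_bool true); rewrite setTI.
  rewrite (_ : _ @^-1` _ = [set 0%E]); first exact: emeasurable_set1.
  by apply/seteqP; split => y /= /eqP.
apply: measurable_fun_ifT => //.
  apply: (measurable_fun_bool true); rewrite setTI.
  rewrite (_ : _ @^-1` _ = [set +oo%E]); first exact: emeasurable_set1.
  by apply/seteqP; split => y /= /eqP.
apply/measurable_EFinP; apply: measurableT_comp => //.
by apply: measurableT_comp => //; apply: measurableT_comp.
Qed.

(** * Measurable versions of the supremum and the integral of a path, and the invariance of their
    quotient *)

Section path_functionals.
Local Open Scope ereal_scope.
Context (R : realType) (delta : {nonneg R}).
Notation K := (path_space (measurableTypeR R) (grid delta)).
Notation regular := (regular_path delta).

Lemma integral_gridT (f : R -> \bar R) : measurable_fun [set: measurableTypeR R] f ->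
  (forall t, 0 <= f t) ->
  \int[grid_mu delta]_t f t = \int[grid_measure delta]_(t in grid delta) f t.
Proof.
move=> mf f0.
rewrite (@ge0_negligible_integral _ _ _ (grid_mu delta) setT (~` grid delta))//.
- by rewrite setTD setCK.
- by apply: measurableC; exact: measurable_grid.
- exact: grid_measureC.
Qed.

Lemma measurable_eval_path (f : R -> R) :
  measurable_fun setT (fun t : measurableTypeR R => eval delta t f).
Proof.
have mp : measurable_fun setT (fun t : R => (t, (f : K))).
  exact: measurable_fun_pair.
exact: (measurableT_comp (@measurable_eval R delta) mp).
Qed.

Lemma int_exp_eval f : regular f ->
  int_exp delta f = \int[grid_mu delta]_t (expR (eval delta t f))%:E.
Proof.
move=> rf; rewrite int_expE integral_gridT.
- by apply: eq_integral => t; rewrite inE => gt; rewrite evalE.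
- apply/measurable_EFinP; apply: measurableT_comp => //.
  exact: measurable_eval_path.
- by move=> t; rewrite lee_fin expR_ge0.
Qed.

Lemma sup_exp_separant : exists e : nat -> R, (forall n, grid delta (e n)) /\
  forall f, regular f -> sup_exp delta f = ereal_sup (range (fun n => (expR (f (e n)))%:E)).
Proof.
have [||e [ge se]] := @grid_separant R delta setT 0%R 0%R (grid0 delta).
- by [].
- by move=> t _; right; exists 1%R.
exists e; split => [n|f rf]; first by case: (ge n).
apply/eqP; rewrite eq_le; apply/andP; split; last first.
  apply: ge_ereal_sup => _ [n _ <-]; apply: ereal_sup_ubound.
  by exists (e n) => //; case: (ge n).
have := @ereal_sup_ubound R (range (fun n => (expR (f (e n)))%:E)).
set S := ereal_sup _ => Sub.
have Sge n : (expR (f (e n)))%:E <= S by apply: Sub; exists n.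
case: S Sub Sge => [s| |] _ Sge; [|by rewrite leey|by have := Sge 0%N].
have s0 : (0 < s)%R.
  by have := Sge 0%N; rewrite lee_fin; apply: lt_le_trans; exact: expR_gt0.
apply: ge_ereal_sup => _ [t gt <-]; rewrite lee_fin -(lnK s0) ler_expR.
apply: (se f rf) => // n; rewrite -ler_expR lnK//.
by rewrite -lee_fin.
Qed.

(** [H] takes the supremum along a separating sequence and integrates [eval]. It is measurable on
    all of path space, and its value is prescribed only on regular paths. *)
Lemma sup_int_functional : exists H : K -> \bar R,
  [/\ measurable_fun setT H, forall f, 0 <= H f &
    forall f, regular f -> H f = sup_exp delta f / int_exp delta f].
Proof.
have [e [ge supE]] := sup_exp_separant.
pose S (f : K) := \int[grid_mu delta]_t (expR (eval delta t f))%:E.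
pose M (f : K) := ereal_sup (range (fun n => (expR (f (e n)))%:E)).
have S0 f : 0 <= S f by apply: integral_ge0 => t _; rewrite lee_fin expR_ge0.
have mS : measurable_fun setT S.
  pose g (tf : measurableTypeR R * K) := (expR (eval delta tf.1 tf.2))%:E.
  apply: (@measurable_fun_fubini_tonelli_G _ _ _ _ _ (grid_mu delta) g).
    apply/measurable_EFinP; apply: measurableT_comp => //.
    exact: (@measurable_eval R delta).
  by move=> z; rewrite lee_fin expR_ge0.
have mM : measurable_fun setT M.
  rewrite (_ : M = (fun f => esups (fun n => (expR (f (e n)))%:E) 0%N)).
    apply: measurable_fun_esups => n; apply/measurable_EFinP.
    apply: measurableT_comp => //.
    exact: (@measurable_coord _ _ (measurableTypeR R) _ _ (ge n)).
  apply/funext => f; rewrite /esups/= /sdrop; congr ereal_sup.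
  by apply/seteqP; split => [_ [n _ <-]|_ [n _ <-]]; exists n.
exists (fun f => M f / S f); split.
- by apply: emeasurable_funM => //; exact: ge0_measurable_inve.
- move=> f; apply: mule_ge0; last by rewrite inve_ge0.
  apply: le_ereal_sup_tmp; exists (expR (f (e 0%N)))%:E; first by exists 0%N.
  by rewrite lee_fin expR_ge0.
- by move=> f rf; rewrite /M /S -supE// -int_exp_eval.
Qed.

Section shift.
Variables (f g : R -> R) (c s : R).
Hypotheses (rf : regular f) (gs : grid delta s).
Hypothesis gE : forall t, grid delta t -> g t = (f (t - s) + c)%R.

Let sup_exp_shift : sup_exp delta g = (expR c)%:E * sup_exp delta f.
Proof.
rewrite /sup_exp -ereal_sup_pZl ?expR_gt0//; congr ereal_sup.
apply/seteqP; split => [_ [t gt <-]|_ [_ [t gt <-] <-]].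
  exists (expR (f (t - s)))%:E; first by exists (t - s)%R => //; exact: gridB.
  by rewrite gE// -EFinM expRD mulrC.
exists (t + s)%R; first exact: gridD.
by rewrite gE ?addrK ?expRD ?EFinM 1?muleC//; exact: gridD.
Qed.

Let int_exp_shift : int_exp delta g = (expR c)%:E * int_exp delta f.
Proof.
pose phi t := (expR (eval delta t f))%:E.
pose psi t := phi (- s - t)%R.
have mphi : measurable_fun [set: R] phi.
  apply/measurable_EFinP; apply: measurableT_comp => //.
  exact: measurable_eval_path.
have phi0 t : 0 <= phi t by rewrite lee_fin expR_ge0.
have gNs : grid delta (- s)%R by rewrite -sub0r; apply: gridB => //; exact: grid0.
have mpsi : measurable_fun [set: R] psi.
  have mB : measurable_fun [set: R] (fun t : R => (- s - t)%R).
    exact: measurable_funB.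
  exact: (measurableT_comp mphi mB).
have mpsi0 : measurable_fun [set: R] (fun t : R => psi (0 - t)%R).
  have mB : measurable_fun [set: R] (fun t : R => (0 - t)%R).
    exact: measurable_funB.
  exact: (measurableT_comp mpsi mB).
have R1 := @integral_grid_reflect R delta 0%R psi (grid0 _) mpsi (fun t => phi0 _).
have R2 := @integral_grid_reflect R delta (- s)%R phi gNs mphi phi0.
have c0 : 0 <= (expR c)%:E by rewrite lee_fin expR_ge0.
have mg : measurable (grid delta : set (measurableTypeR R)).
  exact: measurable_grid.
have R3 := @ge0_integralZl _ _ _ (grid_measure delta) _ mg (fun t => psi (0 - t)%R)
  (measurable_funTS mpsi0) _ (fun t _ => phi0 _) c0.
have pE t : grid delta t -> (expR (g t))%:E = (expR c)%:E * psi (0 - t)%R.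
  move=> gt; rewrite /psi /phi sub0r opprK (addrC (- s)%R).
  rewrite (evalE (gridB gt gs) rf) (gE gt) -EFinM expRD; congr EFin.
  exact: mulrC.
rewrite !int_expE.
transitivity (\int[grid_measure delta]_(t in grid delta)
   ((expR c)%:E * psi (0 - t)%R)).
  by apply: eq_integral => t /set_mem; exact: pE.
etransitivity; first exact: R3.
congr (_ * _); etransitivity; first exact: R1.
etransitivity; first exact: R2.
by apply: eq_integral => t; rewrite inE /phi => gt; rewrite evalE.
Qed.

Lemma sup_int_shift : sup_exp delta g / int_exp delta g = sup_exp delta f / int_exp delta f.
Proof.
rewrite sup_exp_shift int_exp_shift.
have ec : expR c != 0%R by rewrite gt_eqF// expR_gt0.
(* The integral may be [+oo], so [expR c] is taken out of the inverse by cases in the extended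
   reals. *)
have -> : ((expR c)%:E * int_exp delta f)^-1 = ((expR c)^-1)%:E * (int_exp delta f)^-1.
  have S0 : 0 <= int_exp delta f.
    by rewrite int_expE; apply: integral_ge0 => t _; rewrite lee_fin expR_ge0.
  have cpos : (0 < (expR c)^-1)%R by rewrite invr_gt0 expR_gt0.
  case: (int_exp delta f) S0 => [r| |]//.
    rewrite lee_fin le_eqVlt => /predU1P[<-|r0].
      by rewrite mule0 inve0 gt0_muley.
    by rewrite -EFinM !inver mulf_eq0 (negbTE ec) gt_eqF//= invfM EFinM.
  by rewrite gt0_muley ?lte_fin ?expR_gt0// !invey mule0.
by rewrite muleACA -EFinM divff// mul1e.
Qed.

End shift.

(** A zero integral would force the strictly positive integrand to vanish almost everywhere, so
    [grid_mu] would be null, although the grid measure of [[0, 1]] is at least 1. *)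
Lemma int_exp_gt0 f : regular f -> 0 < int_exp delta f.
Proof.
move=> rf; rewrite lt_neqAle; apply/andP; split; last first.
  by rewrite int_expE; apply: integral_ge0 => t _; rewrite lee_fin expR_ge0.
apply/eqP => /esym; rewrite int_exp_eval// => int0.
have mexpf : measurable_fun [set: measurableTypeR R]
    (fun t => (expR (eval delta t f))%:E).
  apply/measurable_EFinP; apply: measurableT_comp => //.
  exact: measurable_eval_path.
have /(ae_eq_integral_abs (grid_mu delta) measurableT mexpf) :
    \int[grid_mu delta]_t `|(expR (eval delta t f))%:E| = 0.
  by rewrite -int0; apply: eq_integral => t _; rewrite gee0_abs// lee_fin expR_ge0.
move=> [N [mN N0 subN]].
have NT : N = setT.
  rewrite -subTset => t _; apply: subN => /= /(_ Logic.I) /eqP.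
  by rewrite eqe gt_eqF// expR_gt0.
have := @grid_measure_itv R delta 1%R ler01.
have -> : grid_measure delta (grid delta `&` `[0%R, 1%R]) = 0.
  apply/eqP; rewrite eq_le measure_ge0 andbT -N0 NT.
  apply: (@le_measure _ _ _ (grid_mu delta)); rewrite ?inE//.
  by apply: measurableI => //; exact: measurable_grid.
by rewrite lee_fin ler10.
Qed.

End path_functionals.

Lemma cadlag_shift (R : realType) (f : R -> R) (s c : R) :
  cadlag f -> cadlag (fun t => f (t - s) + c).
Proof.
move=> [rf lf].
have sub_right (t : R) : (u - s) @[u --> t^'+] --> (t - s)^'+.
  move=> A [e /= e0 eA]; exists e => //= u tu ut.
  apply: eA => /=; last by rewrite ltrD2r.
  by rewrite (_ : t - s - (u - s) = t - u)//; ring.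
have sub_left (t : R) : (u - s) @[u --> t^'-] --> (t - s)^'-.
  move=> A [e /= e0 eA]; exists e => //= u tu ut.
  apply: eA => /=; last by rewrite ltrD2r.
  by rewrite (_ : t - s - (u - s) = t - u)//; ring.
split => t.
  apply: cvgD; last exact: cvg_cst.
  exact: (cvg_comp _ _ (sub_right t) (rf (t - s))).
have /cvg_ex[l fl] := lf (t - s).
apply/cvg_ex; exists (l + c); apply: cvgD; last exact: cvg_cst.
exact: (cvg_comp _ _ (sub_left t) fl).
Qed.

Section m3_identity.
Local Open Scope ereal_scope.
Context (R : realType) (d d' : measure_display).
Context (T : measurableType d) (P : probability T R) (W : T -> R -> R).
Context (T' : measurableType d') (P' : probability T' R).
Variables (p : T' -> nat -> R) (Y : nat -> T' -> R -> R).
Hypothesis cW : cadlag_process W.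
Hypothesis W0 : {ae P, forall w, W w 0%R = 0%R}.
Hypothesis EW : forall t : R, 'E_P[fun w => expR (W w t)] = 1.
Hypothesis construction : max_stable_construction P W P' p Y.
Context (delta : {nonneg R}) (C : R) (C0 : (0 < C)%R).
Context (d0 d1 : measure_display) (T0 : measurableType d0) (P0 : probability T0 R)
  (T1 : measurableType d1) (P1 : probability T1 R).
Variables (F : T0 -> R -> R) (Z : T1 -> nat -> R * R) (G : nat -> T1 -> R -> R).
Hypothesis shapeF : shape_process delta F.
Hypothesis supF : {ae P0, forall w,
  ereal_sup [set (F w t)%:E | t in grid delta] = 0 /\ F w 0%R = 0%R}.
Hypothesis CE : C%:E = m3_constant delta P0 F.
Hypothesis ppp : poisson_point_process P1 (@m3_intensity R delta C) Z.
Hypothesis gridZ : forall w i, grid delta (Z w i).1.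
Hypothesis shapeG : forall i, shape_process delta (G i).
Hypothesis copies : independent_copies (grid delta) P0 F P1 Z G.
Hypothesis law : same_law (grid delta) P' (max_stable p Y) P1 (m3_process Z G).
Notation K := (path_space (measurableTypeR R) (grid delta)).

Let muW := @expo R \x P.
Let muF := m3_measure delta C0 \x P0.
Let pathW : measurableTypeR R * T -> K := shifted_path W.
Let pathF : (measurableTypeR R * measurableTypeR R) * T0 -> K := moved_path delta F.

Let mpathW : measurable_fun setT pathW.
Proof. exact: measurable_shifted_path. Qed.

Let mpathF : measurable_fun setT pathF.
Proof. exact: measurable_moved_path. Qed.

Let lawW := image_measure (@expo R \x P) mpathW.
Let lawF := image_measure (m3_measure delta C0 \x P0) mpathF.

(** Equal laws have equal void probabilities, and [expeR] is injective on the extended reals, so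
    exponents may be compared before they are known to be finite. *)
Let lawWF s : times_in (grid delta) s -> lawW (~` below s) = lawF (~` below s).
Proof.
move=> Ds; have := law (path_sigma_below Ds).
rewrite [LHS](max_stable_void cW construction).
rewrite [RHS](m3_void C0 shapeF ppp gridZ shapeG copies Ds).
by move=> /expeR_inj/oppe_inj.
Qed.

Lemma shifted_above_eq_moved e : (forall n, grid delta (e n)) ->
  (@expo R \x P) [set z | above e (shifted_path W z)] =
  (m3_measure delta C0 \x P0) [set z | above e (moved_path delta F z)].
Proof. by move=> ge; exact: (eq_measure_above ge lawWF). Qed.

Let lawW_gt t x : grid delta t -> lawW [set f : K | x < f t]%R < +oo.
Proof.
move=> gt; have := shifted_path_gt cW x (EW t).
rewrite /lawW /image_measure /= /pushforward /= => ->.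
by rewrite ltry.
Qed.

Let B0 : set K := [set f | 0 < f 0]%R.

Let mB0 : measurable B0.
Proof. by apply: measurable_gt_coord; exact: grid0. Qed.

Lemma integral_path_eq (H : K -> \bar R) : measurable_fun setT H ->
  (forall f, 0 <= H f) ->
  \int[muW]_(z in pathW @^-1` B0) H (pathW z) =
  \int[muF]_(z in pathF @^-1` B0) H (pathF z).
Proof.
move=> mH H0.
have mH0 : measurable_fun B0 H by exact: measurable_funTS.
transitivity (\int[lawW]_(f in B0) H f).
  by rewrite (ge0_integral_pushforward mpathW).
transitivity (\int[lawF]_(f in B0) H f); last first.
  by rewrite (ge0_integral_pushforward mpathF).
apply: eq_measure_integral => A mA AB0.
have := exponent_measure_unique (grid0 delta) lawW_gt lawWF mA.
by rewrite setIidl.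
Qed.

Let regW w : regular_path delta (W w).
Proof. by move=> _; exact: cW.2. Qed.

Let regF w : regular_path delta (F w).
Proof. exact: shape_process_regular. Qed.

Let pathF_regular s q w : grid delta s ->
  (forall t, grid delta t -> pathF ((s, q), w) t = (F w (t - s) + q)%R) /\
  regular_path delta (pathF ((s, q), w)).
Proof.
move=> gs; have pE t : grid delta t -> pathF ((s, q), w) t = (F w (t - s) + q)%R.
  by move=> gt; rewrite /pathF /moved_path/= evalE//; exact: gridB.
split => // d00; have := cadlag_shift s q (regF w d00).
by congr cadlag; apply/funext => t; rewrite pE// grid_eq0.
Qed.

Section functional.
Variable H : K -> \bar R.
Hypotheses (mH : measurable_fun setT H) (H0 : forall f, 0 <= H f).
Hypothesis HE : forall f, regular_path delta f ->
  H f = sup_exp delta f / int_exp delta f.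

Let ray_integral (c : \bar R) (a : R) (D : set R) : 0 <= c ->
  (forall q, D q <-> (0 < q + a)%R) ->
  \int[@expo R]_q ((fun=> c) \_ D) q = c * (expR a)%:E.
Proof.
move=> c0 DE; have -> : D = `](- a)%R, +oo[%classic.
  apply/seteqP; split => q /=; rewrite in_itv/= andbT.
    by move=> /DE; lra.
  by move=> qa; apply/DE; lra.
rewrite -integral_mkcond integral_cst//; congr (_ * _).
by rewrite -[a in RHS]opprK -expo_ray.
Qed.

Let integral_pathW : \int[muW]_(z in pathW @^-1` B0) H (pathW z) =
  \int[P]_w (sup_exp delta (W w) / int_exp delta (W w)).
Proof.
have mB : measurable (pathW @^-1` B0).
  by rewrite -[X in measurable X]setTI; exact: mpathW.
have mHW : measurable_fun setT (fun w => H (W w)).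
  apply: (measurableT_comp mH); apply: measurable_path => t _; exact: cW.1.
rewrite integral_mkcond fubini_tonelli2; last 2 first.
- apply/(measurable_restrictT _ mB); apply: measurable_funTS.
  exact: measurableT_comp.
- by move=> z; apply: erestrict_ge0 => *; exact: H0.
rewrite /fubini_G.
(* For fixed [w] the functional does not depend on the level [q], and the levels with
   [q + W w 0 > 0] have mass [exp (W w 0)], almost surely 1. *)
transitivity (\int[P]_w (H (W w) * (expR (W w 0%R))%:E)).
  apply: eq_integral => w _.
  rewrite -(ray_integral (D := [set q | (0 < q + W w 0)%R]) (H0 _))//.
  apply: eq_integral => q _; rewrite !patchE.
  have HWE : H (pathW (q, w)) = H (W w).
    have rW : regular_path delta (pathW (q, w)).
      move=> _; have := cadlag_shift 0%R q (cW.2 w).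
      by congr cadlag; apply/funext => t; rewrite subr0 addrC.
    rewrite !HE//; apply: (@sup_int_shift _ _ _ _ q 0%R) => //.
      exact: grid0.
    by move=> t _; rewrite subr0 addrC.
  rewrite HWE; congr (if _ then _ else _).
apply: ge0_ae_eq_integral => //.
- apply: emeasurable_funM => //; apply/measurable_EFinP.
  by apply: measurableT_comp => //; exact: cW.1.
- by under eq_fun do rewrite -HE//.
- by move=> w _; rewrite mule_ge0// lee_fin expR_ge0.
- by move=> w _; rewrite -HE.
- by move: W0; apply: filterS => w w0 _; rewrite w0 expR0 mule1 HE.
Qed.

Let S (w : T0) := int_exp delta (F w).

Let mF : measurable_fun setT (F : T0 -> K).
Proof. by apply: measurable_path; exact: shapeF.1. Qed.

Let mHF : measurable_fun setT (fun w => H (F w)).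
Proof. exact: (measurableT_comp mH mF). Qed.

Let mS : measurable_fun setT S.
Proof.
rewrite (_ : S = fun w =>
    \int[grid_mu delta]_t (expR (eval delta t (F w)))%:E); last first.
  by apply/funext => w; rewrite /S int_exp_eval.
pose g (tw : measurableTypeR R * T0) := (expR (eval delta tw.1 (F tw.2)))%:E.
apply: (@measurable_fun_fubini_tonelli_G _ _ _ _ _ (grid_mu delta) g).
  apply/measurable_EFinP; apply: measurableT_comp => //.
  have mg : measurable_fun setT
      (fun tw : measurableTypeR R * T0 => (tw.1 : R, (F tw.2 : K))).
    by apply: measurable_fun_pair => //; exact: (measurableT_comp mF).
  exact: (measurableT_comp (@measurable_eval R delta) mg).
by move=> z; rewrite lee_fin expR_ge0.
Qed.

Let S0 w : 0 <= S w.
Proof. exact: ltW (int_exp_gt0 (regF w)). Qed.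

(** For a fixed shape the functional is constant in [(s, q)]. The heights that make the path
    positive at 0 have mass [exp (F w (- s))], and integrating over [s], after a reflection, gives
    [S w]. *)
Let integral_pathF_section w :
  \int[m3_measure delta C0]_x
    ((fun z => H (pathF z)) \_ (pathF @^-1` B0)) (x, w) =
  H (F w) * (C%:E * S w).
Proof.
have mB : measurable (pathF @^-1` B0).
  by rewrite -[X in measurable X]setTI; exact: mpathF.
pose g x := ((fun z => H (pathF z)) \_ (pathF @^-1` B0)) (x, w).
have mg0 : measurable_fun setT ((fun z => H (pathF z)) \_ (pathF @^-1` B0)).
  apply/(measurable_restrictT _ mB); apply: measurable_funTS.
  exact: (measurableT_comp mH mpathF).
have mg : measurable_fun setT g.
  exact: (measurableT_comp mg0 (pair2_measurable w)).
have g0 x : 0 <= g x by apply: erestrict_ge0 => *; exact: H0.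
transitivity (\int[rescale (NngNum (ltW C0)) (grid_mu delta)]_s
    \int[@expo R]_q g (s, q)).
  exact: (fubini_tonelli1 g mg g0).
have mJ := measurable_fun_fubini_tonelli_F (m2 := @expo R) g mg g0.
have J0 s : 0 <= \int[@expo R]_q g (s, q) by apply: integral_ge0.
transitivity (C%:E * \int[grid_mu delta]_s \int[@expo R]_q g (s, q)).
  exact: ge0_integral_rescale mJ J0.
rewrite muleCA; congr (_ * _).
pose phi t := (expR (eval delta t (F w)))%:E.
have phi0 t : 0 <= phi t by rewrite lee_fin expR_ge0.
have mphi : measurable_fun [set: R] phi.
  apply/measurable_EFinP; apply: measurableT_comp => //.
  exact: measurable_eval_path.
have mphi0 : measurable_fun [set: R] (fun t : R => phi (0 - t)%R).
  have mN : measurable_fun [set: R] (fun t : R => (0 - t)%R).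
    exact: measurable_funB.
  exact: (measurableT_comp mphi mN).
transitivity (\int[grid_measure delta]_(s in grid delta)
    \int[@expo R]_q g (s, q)).
  exact: integral_gridT mJ J0.
transitivity (\int[grid_measure delta]_(s in grid delta)
    (H (F w) * phi (0 - s)%R)).
  apply: eq_integral => s /set_mem gs.
  have g0s : grid delta (0 - s)%R by apply: gridB => //; exact: grid0.
  rewrite /phi (evalE g0s (regF w)).
  rewrite -(ray_integral (D := [set q | (0 < q + F w (0 - s))%R]) (H0 _))//.
  apply: eq_integral => q _; rewrite /g !patchE.
  have [pE rp] := pathF_regular q w gs.
  have -> : H (pathF ((s, q), w)) = H (F w).
    by rewrite !HE//; exact: (@sup_int_shift _ _ _ _ q s).
  have p0 : pathF ((s, q), w) 0%R = (q + F w (0 - s))%R.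
    by rewrite (pE _ (grid0 _)) addrC.
  have -> : (((s, q), w) \in pathF @^-1` B0) =
      (q \in [set q | (0 < q + F w (0 - s))%R]).
    apply/idP/idP => /set_mem h; apply/mem_set.
      by change (0 < q + F w (0 - s))%R; rewrite -p0; exact: h.
    by change (0 < pathF ((s, q), w) 0)%R; rewrite p0; exact: h.
  by [].
have mg' : measurable (grid delta : set (measurableTypeR R)).
  exact: measurable_grid.
have R1 := @ge0_integralZl _ _ _ (grid_measure delta) _ mg' (fun t => phi (0 - t)%R)
  (measurable_funTS mphi0) _ (fun t _ => phi0 _) (H0 (F w)).
etransitivity; first exact: R1.
congr (_ * _); etransitivity.
  exact: (@integral_grid_reflect R delta 0%R phi (grid0 _) mphi phi0).
rewrite /S int_expE; apply: eq_integral => t /set_mem gt.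
by rewrite /phi evalE.
Qed.

Let integral_S : \int[P0]_w S w = (C^-1)%:E.
Proof.
have := congr1 inve CE; rewrite /m3_constant inveK inver gt_eqF// => ->.
by apply: eq_integral => w _; rewrite /S int_expE.
Qed.

Let integral_pathF : \int[muF]_(z in pathF @^-1` B0) H (pathF z) = C%:E.
Proof.
have mB : measurable (pathF @^-1` B0).
  by rewrite -[X in measurable X]setTI; exact: mpathF.
rewrite integral_mkcond fubini_tonelli2; last 2 first.
- apply/(measurable_restrictT _ mB); apply: measurable_funTS.
  exact: (measurableT_comp mH mpathF).
- by move=> z; apply: erestrict_ge0 => *; exact: H0.
rewrite /fubini_G (eq_integral (fun w => H (F w) * (C%:E * S w))); last first.
  by move=> w _; exact: integral_pathF_section.
rewrite -[RHS](integral_probability_cst P0).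
have C0' : 0 <= C%:E by rewrite lee_fin ltW.
(* [S] has expectation [C^-1], so it is almost surely finite; being also positive, it cancels
   against the denominator of the functional. The numerator is 1 because the supremum of [F] is
   0. *)
have Sfin : {ae P0, forall w, setT w -> S w \is a fin_num}.
  apply: integrable_ae => //; apply/integrableP; split => //.
  rewrite (eq_integral S); last by move=> w _; rewrite gee0_abs.
  by rewrite integral_S ltry.
apply: ge0_ae_eq_integral => //.
- by apply: emeasurable_funM => //; exact: measurable_funeM.
- by move=> w _; rewrite mule_ge0// mule_ge0.
- move: supF Sfin; apply: filterS2 => w [sup0 Fw0] /(_ Logic.I) Sf _.
  have sup1 : sup_exp delta (F w) = 1.
    apply/eqP; rewrite eq_le; apply/andP; split; last first.
      apply: ereal_sup_ubound; exists 0%R; first exact: grid0.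
      by rewrite Fw0 expR0.
    apply: ge_ereal_sup => _ [t gt <-]; rewrite -expR0 lee_fin ler_expR.
    rewrite -lee_fin (@le_trans _ _ (ereal_sup [set (F w u)%:E | u in grid delta]))//.
      by apply: ereal_sup_ubound; exists t.
    by rewrite sup0.
  rewrite HE// sup1 mul1e -/(S w) muleCA mulVe ?mule1//.
  by rewrite gt_eqF// int_exp_gt0.
Qed.

Lemma m3_constant_functional :
  C%:E = \int[P]_w (sup_exp delta (W w) / int_exp delta (W w)).
Proof. by rewrite -integral_pathF -integral_path_eq// integral_pathW. Qed.

End functional.

Lemma m3_constantE : C%:E = \int[P]_w (sup_exp delta (W w) / int_exp delta (W w)).
Proof.
have [H [mH H0 HE]] := sup_int_functional delta.
exact: m3_constant_functional mH H0 HE.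
Qed.

Lemma moved_above_ge (a : R) (e : nat -> R) : (0 <= a)%R ->
  (forall n, grid delta (e n)) ->
  (forall f, regular_path delta f -> forall t, grid delta t -> (0 <= t <= a)%R ->
    (0 < f t)%R -> above e f) ->
  (C * a)%:E <= (m3_measure delta C0 \x P0) [set z | above e (moved_path delta F z)].
Proof.
move=> a0 ge abv.
have mA : measurable [set z | above e (moved_path delta F z)].
  rewrite -[X in measurable X]setTI.
  exact: (mpathF measurableT (measurable_above ge)).
rewrite product_measure_ysection// -[leLHS](integral_probability_cst P0).
apply: ae_ge0_le_integral => //.
- by move=> w _; rewrite lee_fin mulr_ge0// ltW.
- exact: measurable_fun_ysection.
- move: supF; apply: filterS => w [_ Fw0] _.
  pose I : set (measurableTypeR R) := grid delta `&` `[0%R, a].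
  have mI : measurable I by apply: measurableI => //; exact: measurable_grid.
  have mIr : measurable (I `*` (`]0%R, +oo[%classic : set (measurableTypeR R))).
    exact: measurableX.
  (* The heights [q > 0] have mass [exp 0 = 1], so the rectangle has measure [C] times that of the
     window. *)
  apply: (@le_trans _ _ (m3_measure delta C0 (I `*` `]0%R, +oo[%classic))).
    have -> : m3_measure delta C0 (I `*` `]0%R, +oo[%classic) =
        C%:E * grid_measure delta I.
      etransitivity; first exact: product_measure1E.
      by rewrite [X in _ * X]expo_ray oppr0 expR0 mule1.
    by rewrite EFinM lee_pmul2l//; exact: grid_measure_itv.
  apply: le_measure; rewrite ?inE//.
    exact: measurable_ysection.
  move=> [s q] [/= [gs]]; rewrite !in_itv/= => sa /andP[q0 _].
  rewrite ysectionE /=.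
  have [pE rp] := pathF_regular q w gs.
  apply: (abv _ rp s) => //.
  by rewrite (pE _ gs) subrr Fw0 add0r.
Qed.

End m3_identity.

(** * Windowed suprema and the Pickands constant *)

Section window.
Local Open Scope ereal_scope.
Context (R : realType) (d d' : measure_display).
Context (T : measurableType d) (P : probability T R) (W : T -> R -> R).
Context (T' : measurableType d') (P' : probability T' R).
Variables (p : T' -> nat -> R) (Y : nat -> T' -> R -> R).
Hypothesis cW : cadlag_process W.
Hypothesis construction : max_stable_construction P W P' p Y.
Hypothesis stat : stationary P' (max_stable p Y).
Context (delta : {nonneg R}).

Definition window (a b : R) : set R := grid delta `&` `[a, b].

Definition window_sup (a b : R) : \bar R :=
  \int[P]_w ereal_sup [set (expR (W w t))%:E | t in window a b].

Lemma window_separant a b : grid delta a -> (a <= b)%R ->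
  exists e : nat -> R, (forall n, grid delta (e n)) /\
    forall f, regular_path delta f ->
      (above e f <-> exists2 t, window a b t & (0 < f t)%R).
Proof.
move=> ga ab.
have [| |e [eI se]] := @grid_separant R delta `[a, b] a b ga.
- by rewrite /= in_itv/= lexx ab.
- move=> t /=; rewrite in_itv/= => /andP[at_]; rewrite le_eqVlt.
  move=> /predU1P[->|tb]; [by left|right].
  exists (b - t)%R; first by rewrite subr_gt0.
  by move=> u /=; rewrite !in_itv/= => /andP[tu ub]; apply/andP; split; lra.
exists e; split => [n|f rf]; first by case: (eI n).
split => [[n fn]|[t [gt It] ft]]; first by exists (e n) => //; exact: eI.
apply: contrapT => nab.
have /(se f rf) /(_ t gt It) : (forall n, f (e n) <= 0)%R.
  by move=> n; rewrite leNgt; apply/negP => fn; apply: nab; exists n.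
by rewrite leNgt ft.
Qed.

Lemma window_nonempty a b : grid delta a -> (a <= b)%R -> window a b !=set0.
Proof. by move=> ga ab; exists a; split => //=; rewrite in_itv/= lexx ab. Qed.

Let muW := @expo R \x P.

Let regular_shifted_path z : regular_path delta (shifted_path W z).
Proof.
move=> _; have := cadlag_shift 0%R z.1 (cW.2 z.2).
by congr cadlag; apply/funext => t; rewrite subr0 addrC.
Qed.

Let up a b := [set z | exists2 t, window a b t & (0 < shifted_path W z t)%R].

Let upE a b e : (forall f, regular_path delta f ->
    (above e f <-> exists2 t, window a b t & (0 < f t)%R)) ->
  up a b = [set z | above e (shifted_path W z)].
Proof.
move=> eE; apply/seteqP; split => z /=; first by move/eE; apply.
by move/eE; apply.
Qed.

Let measurable_up a b : grid delta a -> (a <= b)%R -> measurable (up a b).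
Proof.
move=> ga ab; have [e [ge /upE ->]] := window_separant ga ab.
rewrite -[X in measurable X]setTI.
exact: (@measurable_shifted_path _ _ _ _ cW (grid delta) measurableT _ (measurable_above ge)).
Qed.

Let window_supE a b : grid delta a -> (a <= b)%R -> window_sup a b = muW (up a b).
Proof.
move=> ga ab; symmetry.
exact: shifted_path_up (window_nonempty ga ab) (measurable_up ga ab).
Qed.

(** Rewriting the expected supremum as the mass of an event on countably many grid times allows it
    to be compared with the second exponent measure. *)
Lemma window_sup_above a b : grid delta a -> (a <= b)%R ->
  exists e : nat -> R, [/\ forall n, grid delta (e n),
    forall f, regular_path delta f ->
      (above e f <-> exists2 t, window a b t & (0 < f t)%R) &
    window_sup a b = muW [set z | above e (shifted_path W z)]].
Proof.
move=> ga ab; have [e [ge eE]] := window_separant ga ab.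
by exists e; split => //; rewrite window_supE// (upE eE).
Qed.

(** [W] itself need not be stationary. Stationarity of the maxima makes the void probabilities,
    hence the exponent measure, shift invariant, and the expected supremum is a mass of that
    measure. *)
Lemma window_sup_shift a b h : grid delta a -> grid delta h -> (a <= b)%R ->
  window_sup (a + h) (b + h) = window_sup a b.
Proof.
move=> ga gh ab; rewrite !window_supE ?lerD2r//; last exact: gridD.
have [e [ge eE]] := window_separant ga ab.
pose K := path_space (measurableTypeR R) [set: R].
pose path : measurableTypeR R * T -> K := shifted_path W.
pose pathh : measurableTypeR R * T -> K := fun z t => shifted_path W z (t + h).
have mpath : measurable_fun setT path by exact: measurable_shifted_path.
have mpathh : measurable_fun setT pathh.
  apply: measurable_path => t _; apply: measurable_funD => //.
  by apply: (measurableT_comp (cW.1 (t + h)%R)).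
have := @eq_measure_above R setT (image_measure muW mpathh) (image_measure muW mpath) e.
have -> : up (a + h) (b + h) = pathh @^-1` above e.
  apply/seteqP; split => z /=.
    move=> [t [gt]]; rewrite /= in_itv/= => tab zt; apply/eE.
      move=> d00; have := cadlag_shift (- h)%R 0%R (regular_shifted_path z d00).
      by congr cadlag; apply/funext => u; rewrite opprK addr0.
    exists (t - h)%R; last by rewrite /pathh subrK.
    split; first exact: gridB.
    by rewrite /= in_itv/=; apply/andP; split; lra.
  move/eE => []; first (move=> d00; have := cadlag_shift (- h)%R 0%R (regular_shifted_path z d00)).
    by congr cadlag; apply/funext => u; rewrite opprK addr0.
  move=> t [gt]; rewrite /= in_itv/= => tab zt; exists (t + h)%R => //.
  split; first exact: gridD.
  by rewrite /= in_itv/=; apply/andP; split; lra.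
rewrite (upE eE); apply => // s _.
have h1 : P' [set w | forall tx, tx \in s -> (max_stable p Y w (tx.1 + h) <= tx.2%:E)%E] =
    P' [set w | forall tx, tx \in s -> (max_stable p Y w tx.1 <= tx.2%:E)%E].
  by have := stat h (@path_sigma_below R setT s (fun _ _ => Logic.I)).
(* The shift is moved from the process to the times, so that [max_stable_void] covers both sides. *)
pose sh := [seq (tx.1 + h, tx.2)%R | tx <- s].
have h2 : P' [set w | forall tx, tx \in s -> (max_stable p Y w (tx.1 + h) <= tx.2%:E)%E] =
    P' [set w | forall tx, tx \in sh -> (max_stable p Y w tx.1 <= tx.2%:E)%E].
  congr (P' _); apply/seteqP; split => w /= H.
    by move=> _ /mapP[tx txs ->]; exact: H.
  by move=> tx txs; apply: (H (tx.1 + h, tx.2)%R); apply/mapP; exists tx.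
move: h1; rewrite h2 (max_stable_void cW construction).
rewrite (max_stable_void cW construction) => /expeR_inj/oppe_inj h3.
etransitivity; last exact: h3.
congr (muW _); apply/seteqP; split => z /= H H'; apply: H.
  move=> tx txs; apply: (H' (tx.1 + h, tx.2)%R); apply/mapP; exists tx => //.
by move=> _ /mapP[tx txs ->]; exact: H'.
Qed.

Lemma le_window_sup a b c : grid delta a -> (a <= b)%R -> (b <= c)%R ->
  window_sup a b <= window_sup a c.
Proof.
move=> ga ab bc; have ac := le_trans ab bc.
rewrite !window_supE//; apply: le_measure; rewrite ?inE.
- exact: measurable_up.
- exact: measurable_up.
- move=> z [t [gt]]; rewrite /= in_itv/= => tab zt; exists t => //; split => //.
  by rewrite /= in_itv/=; apply/andP; split; lra.
Qed.

(** A union bound: a path positive somewhere on [[a, c]] is so on [[a, b]] or on [[b, c]]. *)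
Lemma window_sup_subadditive a b c : grid delta a -> grid delta b ->
  (a <= b)%R -> (b <= c)%R -> window_sup a c <= window_sup a b + window_sup b c.
Proof.
move=> ga gb ab bc; have ac := le_trans ab bc.
rewrite !window_supE//.
apply: le_trans (measureU2 _ (measurable_up ga ab) (measurable_up gb bc)).
apply: le_measure; rewrite ?inE.
- exact: measurable_up.
- by apply: measurableU; exact: measurable_up.
- move=> z [t [gt]]; rewrite /= in_itv/= => /andP[at_ tc] zt.
  by have [tb|bt] := leP t b; [left|right]; exists t => //; split => //=;
    rewrite in_itv/=; apply/andP; split; lra.
Qed.

Lemma window_sup_mulrn a n : grid delta a -> (0 < a)%R ->
  window_sup 0 (a *+ n.+1) <= n.+1%:R%:E * window_sup 0 a.
Proof.
move=> ga a0; elim: n => [|n IH]; first by rewrite mulr1n mul1e.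
have gna := grid_mulrn n.+1 ga.
have na0 : (0 <= a *+ n.+1)%R by rewrite mulrn_wge0// ltW.
have g0 := grid0 delta.
have w0 : 0 <= window_sup 0 a by rewrite window_supE// ltW.
apply: (le_trans (window_sup_subadditive (b := a *+ n.+1) g0 gna na0 _)).
  by rewrite [leRHS]mulrSr lerDl ltW.
have := @window_sup_shift 0%R a _ g0 gna (ltW a0).
rewrite add0r [in window_sup _ (a *+ n.+2)]mulrS => ->.
rewrite -[in leRHS]natr1 EFinD ge0_muleDl ?lee_fin// mul1e.
exact: leeD.
Qed.

End window.

(** * Growth rate of a function that is subadditive along the grid *)

Section growth_rate.
Local Open Scope ereal_scope.
Context (R : realType) (delta : {nonneg R}).

Lemma grid_floor (t : R) : (0 <= t)%R ->
  exists g, [/\ grid delta g, (0 <= g)%R, (t - delta%:num <= g)%R & (g <= t)%R].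
Proof.
move=> t0; have [d0|d0] := eqVneq delta%:num 0%R.
  by exists t; rewrite grid_eq0// d0 subr0.
have dpos : (0 < delta%:num)%R by rewrite lt_neqAle eq_sym d0/=.
exists (delta%:num * (Num.truncn (t / delta%:num))%:R)%R; split.
- by rewrite grid_neq0//; exists (Num.truncn (t / delta%:num)) => //; rewrite pmulrn.
- by rewrite mulr_ge0.
- have := truncnS_gt (t / delta%:num)%R.
  rewrite ltr_pdivrMr// -natr1 mulrDl mul1r; lra.
- rewrite mulrC -ler_pdivlMr// truncn_le// divr_ge0// ltW.
Qed.

Lemma grid_gt0 : exists2 a, grid delta a & (0 < a)%R.
Proof.
have [d0|d0] := eqVneq delta%:num 0%R; first by exists 1%R; rewrite ?grid_eq0.
exists delta%:num; last by rewrite lt_neqAle eq_sym d0/=.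
by rewrite grid_neq0//; exists 1%Z => //; rewrite mulr1.
Qed.

Variables (f : R -> \bar R) (C : R).
Hypothesis C0 : (0 < C)%R.
Hypothesis f_nd : forall a b, (0 <= a)%R -> (a <= b)%R -> f a <= f b.
Hypothesis f_sub : forall a n, grid delta a -> (0 < a)%R ->
  f (a *+ n.+1) <= n.+1%:R%:E * f a.
Hypothesis f_ge : forall t, (0 <= t)%R -> (C * t)%:E <= f t.

Let h t := fine (f t).

Let finite_rate_cvg : (forall t, (0 <= t)%R -> f t \is a fin_num) ->
  exists2 L, (C <= L)%R & (t^-1)%:E * f t @[t --> +oo%R] --> L%:E.
Proof.
move=> ffin; have fE t : (0 <= t)%R -> f t = (h t)%:E.
  by move=> t0; rewrite fineK// ffin.
(* The infimum runs over the grid only, since subadditivity is available at multiples of grid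
   points; other times are rounded to these. *)
pose S := [set (h a / a)%R | a in [set a | grid delta a /\ (0 < a)%R]].
have h_ge t : (0 <= t)%R -> (C * t <= h t)%R.
  by move=> t0; rewrite -lee_fin -fE//; exact: f_ge.
have lbS : lbound S C.
  by move=> _ [a [ga a0] <-]; rewrite ler_pdivlMr// h_ge// ltW.
have S0 : S !=set0.
  by have [a ga a0] := grid_gt0; exists (h a / a)%R; exists a.
have hasS : has_inf S by split => //; exists C.
pose L := inf S.
have CL : (C <= L)%R by apply: lb_le_inf.
have L0 : (0 < L)%R by apply: lt_le_trans CL.
exists L => //; apply: cvg_EFin.
  near=> t; have t0 : (0 <= t)%R by near: t; apply: nbhs_pinfty_ge; exact: num_real.
  by rewrite fE.
apply/cvgrPdist_le => e e0.
have [_ [a [ga a0] <-] haL] := @inf_adherent _ S (e / 2) (divr_gt0 e0 (ltr0n _ 2)) hasS.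
near=> t.
have t0 : (0 < t)%R by near: t; apply: nbhs_pinfty_gt; exact: num_real.
(* The two thresholds absorb the rounding errors: [L * delta] when [t] is rounded down to the grid,
   and one extra [h a] when it is rounded up to a multiple of [a]. *)
have t1 : (L * delta%:num / e <= t)%R by near: t; apply: nbhs_pinfty_ge; exact: num_real.
have t2 : (2 * h a / e <= t)%R by near: t; apply: nbhs_pinfty_ge; exact: num_real.
rewrite [(fine \o _) _]/=.
have -> : fine ((t^-1)%:E * f t) = (h t / t)%R by rewrite fE ?ltW//= mulrC.
have lower : (L - e <= h t / t)%R.
  have [g [gg g0 tg gt]] := grid_floor (ltW t0).
  rewrite ler_pdivlMr//.
  have hg : (h g <= h t)%R.
    by rewrite -lee_fin -(fE g)// -(fE t (ltW t0)) f_nd.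
  have Lg : (L * g <= h g)%R.
    move: g0; rewrite le_eqVlt => /predU1P[<-|g0].
      by rewrite mulr0 (le_trans _ (h_ge _ (lexx _)))// mulr0.
    rewrite -ler_pdivlMr//; apply: ge_inf; first by case: hasS.
    by exists g.
  move: t1; rewrite ler_pdivrMr// => t1.
  have : (L * (t - delta%:num) <= L * g)%R by rewrite ler_pM2l.
  lra.
have upper : (h t / t <= L + e)%R.
  rewrite ler_pdivrMr//.
  pose n := Num.truncn (t / a).
  have tn : (t <= a *+ n.+1)%R.
    by rewrite -mulr_natr -ler_pdivrMl// mulrC ltW// truncnS_gt.
  have na : (n%:R * a <= t)%R.
    by rewrite -ler_pdivlMr// truncn_le// divr_ge0// ltW.
  have hn : (h t <= n.+1%:R * h a)%R.
    rewrite -lee_fin EFinM -(fE t (ltW t0)) -(fE a (ltW a0)).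
    by apply: le_trans (f_sub n ga a0); apply: f_nd => //.
  have ha0 : (0 <= h a)%R.
    by rewrite (le_trans _ (h_ge _ (ltW a0)))// mulr_ge0// ltW.
  have haL' : (h a <= (L + e / 2) * a)%R by rewrite -ler_pdivrMr// ltW.
  have nh : (n%:R * h a <= (L + e / 2) * t)%R.
    apply: (@le_trans _ _ (n%:R * ((L + e / 2) * a))%R); first by rewrite ler_wpM2l.
    by rewrite mulrCA ler_wpM2l// addr_ge0// ?divr_ge0// ltW.
  move: t2; rewrite ler_pdivrMr// => t2.
  move: hn; rewrite -natr1; lra.
by rewrite ler_distlC; apply/andP; split; lra.
Unshelve. all: by end_near. Qed.

(* Fekete's argument: the rate converges to its infimum over the grid. *)
Lemma growth_rate_ge : C%:E <= lim ((t^-1)%:E * f t @[t --> +oo%R]).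
Proof.
have f0 t : (0 <= t)%R -> 0 <= f t.
  move=> t0; apply: le_trans (f_ge t0).
  by rewrite lee_fin mulr_ge0// ltW.
(* [lim] has a default value in the absence of a limit, so convergence is needed in every case: one
   finite value at a positive grid point bounds [f] at all times, and otherwise the rate is
   eventually [+oo]. *)
have [[a [ga a0 faoo]]|nfin] :=
    pselect (exists a, [/\ grid delta a, (0 < a)%R & f a < +oo]).
  have [t t0|L CL cL] := finite_rate_cvg; last by rewrite (cvg_lim _ cL).
  rewrite ge0_fin_numE ?f0//.
  pose n := Num.truncn (t / a).
  have tn : (t <= a *+ n.+1)%R.
    by rewrite -mulr_natr -ler_pdivrMl// mulrC ltW// truncnS_gt.
  apply: (le_lt_trans (f_nd t0 tn)); apply: (le_lt_trans (f_sub n ga a0)).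
  by rewrite lte_mul_pinfty.
have [a ga a0] := grid_gt0.
have faE : f a = +oo.
  apply/eqP; rewrite -leye_eq leNgt; apply/negP => faoo; apply: nfin.
  by exists a.
suff -> : lim ((t^-1)%:E * f t @[t --> +oo%R]) = +oo by rewrite leey.
apply: cvg_lim => //; apply: cvg_near_cst; near=> t.
have ta : (a <= t)%R by near: t; apply: nbhs_pinfty_ge; exact: num_real.
have -> : f t = +oo.
  by apply/eqP; rewrite -leye_eq -faE; exact: f_nd (ltW a0) ta.
by rewrite gt0_muley// lte_fin invr_gt0 (lt_le_trans a0).
Unshelve. all: by end_near. Qed.

End growth_rate.

Theorem theorem4 (R : realType)
    (d : measure_display) (T : measurableType d) (P : probability T R)
    (W : T -> R -> R)
    (d' : measure_display) (T' : measurableType d') (P' : probability T' R)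
    (p : T' -> nat -> R) (Y : nat -> T' -> R -> R) :
  cadlag_process W ->
  {ae P, forall w, W w 0 = 0} ->
  (forall t : R, 'E_P[fun w => expR (W w t)] = 1)%E ->
  max_stable_construction P W P' p Y ->
  stationary P' (max_stable p Y) ->
  cadlag_paths P' (max_stable p Y) ->
  forall (delta : {nonneg R}) (C : R),
  m3_representation delta P' (max_stable p Y) C ->
  [/\ 0 < C,
      C%:E = (\int[P]_w (sup_exp delta (W w) / int_exp delta (W w)))%E
    & (C%:E <= pickands delta P W)%E].
Proof.
move=> cW W0 EW construction stat _ delta C.
move=> [d0 [T0 [P0 [F [d1 [T1 [P1 [Z [G [shape [points law]]]]]]]]]]].
have [shapeF [supF [C0 CE]]] := shape.
have [ppp [gridZ [shapeG copies]]] := points.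
split => //.
  exact: (m3_constantE cW W0 EW construction C0 shapeF supF CE ppp gridZ shapeG copies law).
apply: (@growth_rate_ge R delta (window_sup P W delta 0) C C0) => [a b|a n|t t0].
- exact: (le_window_sup P cW (grid0 delta)).
- exact: (window_sup_mulrn cW construction stat).
(* The linear lower bound: the event that defines the windowed supremum is transferred to the second
   exponent measure, where the peaks in the window suffice. *)
have [e [ge eE ->]] := window_sup_above P cW (grid0 delta) t0.
rewrite (shifted_above_eq_moved cW construction C0 shapeF ppp gridZ shapeG copies law ge).
apply: (moved_above_ge C0 shapeF supF t0 ge) => f rf s gs st fs.
by apply/(eE f rf); exists s.
Qed.
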